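(* There exists a unique way to assign to every unitary graded associative algebra $A$ (over $\mathbb{K}$) a morphism of graded vector spaces \[ \Psi\colon \mathrm{Aff}^*(A)\to D(A),\qquad u\mapsto \Psi_u=\sum_{n=0}^{\infty}\Psi^n_u,\qquad \Psi^n_u\in D_{n-1}(A),\] such that the following conditions are satisfied: 1. (generalized Jacobi) for every $A$, $\Psi$ is a morphism of graded Lie algebras; 2. (naturality) for every morphism $\alpha\colon A\to B$ of unitary graded associative algebras, every $x\in A$, every pair of linear maps $f\in \mathrm{End}^*(A)$, $g\in \mathrm{End}^*(B)$ such that $g\alpha=\alpha f$, and every $n\ge 0$, we have \[\alpha\Psi^n_x=\Psi^n_{\alpha(x)}\alpha^{\odot n},\qquad \alpha\Psi^n_f=\Psi^n_g\alpha^{\odot n}\quad\text{as maps } A^{\odot n}\to B;\] 3. (base change) the operators $\Psi^n_1$ (where $1\in A$ is the unit) and $\Psi^n_{Id}$ (where $Id=Id_A$) are multilinear over the centre of $A$; more precisely, if $c\in A$ is homogeneous and $ac=(-1)^{|a||c|}ca$ for every homogeneous $a\in A$, then \[\Psi^n_1(a_1,\ldots,a_nc)=\Psi^n_1(a_1,\ldots,a_n)c,\qquad \Psi^n_{Id}(a_1,\ldots,a_nc)=\Psi^n_{Id}(a_1,\ldots,a_n)c\] for every $a_1,\ldots,a_n\in A$; 4. (initial terms) for every $x\in A$ and $f\in \mathrm{End}^*(A)$ we have $\Psi^0_x=x$ and $\Psi^0_f=f(1)$; 5. (gauge fixing) for $A=\mathbb{K}$ we have $\Psi^n_{Id}=0$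 for every $n>0$.
   Context: $\mathbb{K}$ is a fixed field of characteristic $0$; all graded vector spaces and graded algebras are $\mathbb{Z}$-graded over $\mathbb{K}$, and $|v|$ denotes the degree of a homogeneous element $v$. $V^{\odot n}$ is the $n$th (graded) symmetric power of $V$; a linear map $f\colon V^{\odot n}\to W$ is identified with the graded symmetric multilinear operator $f(v_1,\ldots,v_n)=f(v_1\odot\cdots\odot v_n)$. $\mathrm{End}^*(V)=\mathrm{Hom}^*_{\mathbb{K}}(V,V)=\bigoplus_{n\in\mathbb{Z}}\mathrm{Hom}^n_{\mathbb{K}}(V,V)$. For a graded vector space $V$ put $D(V)=\prod_{n\ge -1}D_n(V)$, with $D_{-1}(V)=V$ and $D_n(V)=\mathrm{Hom}^*_{\mathbb{K}}(V^{\odot n+1},V)$ for $n\ge 0$. $D(V)$ is a graded Lie algebra under the Nijenhuis-Richardson bracket $[f,g]=f\barwedge g-(-1)^{|f||g|}g\barwedge f$, where for $f\in D_n(V)$, $g\in D_m(V)$ the product $f\barwedge g\in D_{n+m}(V)$ is: $f\barwedge g=0$ if $f\in D_{-1}(V)=V$; $f\barwedge g(v_1,\ldots,v_n)=f(g,v_1,\ldots,v_n)$ if $n\ge 0$ and $g\in D_{-1}(V)=V$; and for $n,m\ge 0$ \[ f\barwedge g(v_0,\ldots,v_{n+m})=\sum_{\sigma\in S(m+1,n)}\epsilon(\sigma)f(g(v_{\sigma(0)},\ldots,v_{\sigma(m)}),v_{\sigma(m+1)},\ldots,v_{\sigma(m+n)}),\] where $S(m+1,n)$ is the set of permutations $\sigma$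 of $0,\ldots,n+m$ with $\sigma(0)<\cdots<\sigma(m)$ and $\sigma(m+1)<\cdots<\sigma(m+n)$, and $\epsilon(\sigma)=(-1)^\alpha$ is the Koszul sign, $\alpha$ being the number of pairs $i<j$ with $\sigma(i)>\sigma(j)$ and $|v_i||v_j|$ odd. $\mathrm{Aff}^*(V)=\{f\in\mathrm{End}^*(V\oplus\mathbb{K})\mid f(V\oplus\mathbb{K})\subseteq V\}$, a graded Lie subalgebra of $\mathrm{End}^*(V\oplus\mathbb{K})$ with the graded commutator bracket. It is identified with the graded Lie subalgebra $D_{-1}(V)\times D_0(V)=V\times\mathrm{End}^*(V)$ of $D(V)$, the pair $(x,f)$ corresponding to the map $v+t\mapsto f(v)+tx$ ($v\in V$, $t\in\mathbb{K}$). In particular elements $x\in A$ and $f\in\mathrm{End}^*(A)$ are regarded as elements of $\mathrm{Aff}^*(A)$, with $[f,x]=f(x)$ and $[f,g]$ the graded commutator for $f,g\in \mathrm{End}^*(A)$.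
   Formalization: In the Nijenhuis-Richardson bracket, the Koszul sign counts pairs i<j with σ(i)>σ(j) and |v_σ(i)||v_σ(j)| odd (standard), instead of |v_i||v_j| odd, since with the latter the product of two graded symmetric operators need not be graded symmetric. *)

(* Defs.v *)
From HB Require Import structures.
From mathcomp Require Import all_boot all_order all_fingroup all_algebra.
From mathcomp Require Import boolp functions.

Set Implicit Arguments.
Unset Strict Implicit.
Unset Printing Implicit Defensive.

Import GRing.Theory.
Local Open Scope ring_scope.

(* A grading V = \bigoplus_i V_i is given by the projections of V onto the
   V_i; V_i is the range of [gproj i]. *)
HB.mixin Record Lmodule_isGraded (K : fieldType) V of GRing.Lmodule K V := {
  gproj : int -> V -> V;
  gproj_linear : forall i, linear (gproj i);
  gprojK : forall i j v, gproj i (gproj j v) = if i == j then gproj j v else 0;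
  gproj_sum : forall v, exists s : seq int, uniq s /\ v = \sum_(i <- s) gproj i v
}.

#[short(type="gradedLmodType")]
HB.structure Definition GradedLmodule (K : fieldType) :=
  {V of GRing.Lmodule K V & Lmodule_isGraded K V}.

HB.instance Definition _ (K : fieldType) (V : gradedLmodType K) (i : int) :=
  GRing.isLinear.Build K V V *:%R (@gproj K V i) (@gproj_linear K V i).

(* v \in homog i says that v lies in V_i, i.e. that |v| = i or v = 0. *)
Definition homog (K : fieldType) (V : gradedLmodType K) (i : int) : {pred V} :=
  fun v => gproj i v == v.

(* Unitary graded associative algebras. The product is introduced here because
   MathComp's algType excludes the zero algebra. *)
HB.mixin Record GradedLmodule_isGradedAlgebra (K : fieldType) A
    of GradedLmodule K A := {
  gone : A;
  gmul : A -> A -> A;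
  gmulA : associative gmul;
  gmul1l : left_id gone gmul;
  gmul1r : right_id gone gmul;
  gmul_linearl : forall y, linear (fun x => gmul x y);
  gmul_linearr : forall x, linear (gmul x);
  gone_deg : gone \in homog 0;
  gmul_deg : forall i j x y,
    x \in homog i -> y \in homog j -> gmul x y \in homog (i + j)
}.

#[short(type="gradedAlgType")]
HB.structure Definition GradedAlgebra (K : fieldType) :=
  {A of GradedLmodule K A & GradedLmodule_isGradedAlgebra K A}.

Definition galg_morphism (K : fieldType) (A B : gradedAlgType K) (alpha : A -> B)
    : Prop :=
  [/\ linear alpha,
      alpha gone = gone,
      forall x y, alpha (gmul x y) = gmul (alpha x) (alpha y)
    & forall i x, x \in homog i -> alpha x \in homog i].

(* The algebra K, concentrated in degree 0. *)
Section GroundField.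
Variable K : fieldType.

Let proj0 (i : int) (x : K^o) : K^o := if i == 0 then x else 0.

Let proj0_linear i : linear (proj0 i).
Proof. by move=> a x y; rewrite /proj0; case: ifP => // _; rewrite scaler0 addr0. Qed.

Let proj0K i j x : proj0 i (proj0 j x) = if i == j then proj0 j x else 0.
Proof.
rewrite /proj0; have [->|ne0i] := eqVneq i 0; last first.
  by case: (i =P j) => // <-; rewrite (negPf ne0i).
by rewrite eq_sym; case: eqP.
Qed.

Let proj0_sum x : exists s : seq int, uniq s /\ x = \sum_(i <- s) proj0 i x.
Proof. by exists [:: 0]; rewrite big_seq1 /proj0 eqxx. Qed.

HB.instance Definition _ :=
  Lmodule_isGraded.Build K K^o proj0_linear proj0K proj0_sum.

Let K_one : (1 : K^o) \in homog 0.
Proof. exact: eqxx. Qed.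

Let K_mul i j (x y : K^o) :
  x \in homog i -> y \in homog j -> x * y \in homog (i + j).
Proof.
rewrite /homog !unfold_in /gproj /= /proj0.
have [->|_] := eqVneq i 0; last by move=> /eqP <- _; rewrite mul0r; case: ifP.
have [->|_] := eqVneq j 0; first by rewrite addr0.
by move=> _ /eqP <-; rewrite mulr0; case: ifP.
Qed.

Let K_linl (y : K^o) : linear (fun x : K^o => x * y).
Proof. by move=> a u v; rewrite mulrDl scalerAl. Qed.

Let K_linr (x : K^o) : linear (fun y : K^o => x * y).
Proof. by move=> a u v; rewrite mulrDr scalerAr. Qed.

HB.instance Definition _ := GradedLmodule_isGradedAlgebra.Build K K^o
  (@mulrA K) (@mul1r K) (@mulr1 K) K_linl K_linr K_one K_mul.

End GroundField.

Section HomogeneousSpan.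
Variables (K : fieldType) (W : lmodType K) (H : int -> W -> Prop).

(* The sum \sum_k H k inside W, i.e. the finite sums of elements of the H k. *)
Definition deg_sum (f : W) : Prop :=
  exists s : seq (int * W),
    (forall t, t \in s -> H t.1 t.2) /\ f = \sum_(t <- s) t.2.

Lemma deg_sum0 : deg_sum 0.
Proof. by exists [::]; rewrite big_nil. Qed.

Lemma deg_sumD f g : deg_sum f -> deg_sum g -> deg_sum (f + g).
Proof.
move=> [s [Hs ->]] [t [Ht ->]]; exists (s ++ t); rewrite big_cat; split=> // x.
by rewrite mem_cat => /orP[/Hs|/Ht].
Qed.

Lemma deg_sum_base k f : H k f -> deg_sum f.
Proof.
by move=> Hf; exists [:: (k, f)]; rewrite big_seq1; split=> // t /[!inE]/eqP->.
Qed.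

Lemma deg_sum_ind (P : W -> Prop) :
  P 0 -> (forall k f g, H k f -> P g -> P (f + g)) ->
  forall f, deg_sum f -> P f.
Proof.
move=> P0 PD f [s [+ ->]]; elim: s => [|[k g] s IHs] Hs; rewrite ?big_nil //.
rewrite big_cons; apply: (PD k); first exact: (Hs (k, g) (mem_head _ _)).
by apply: IHs => t ts; apply: Hs; rewrite inE ts orbT.
Qed.

Lemma deg_sum_closed : (forall k a f, H k f -> H k (a *: f)) ->
  GRing.subsemimod_closed (fun f => `[< deg_sum f >]).
Proof.
move=> HZ; split; [split|].
- exact/asboolP/deg_sum0.
- by move=> f g /asboolP Hf /asboolP Hg; apply/asboolP/deg_sumD.
- move=> a f /asboolP Hf; apply/asboolP; elim/deg_sum_ind: Hf => [|k h g Hh Hg].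
    by rewrite scaler0; apply: deg_sum0.
  by rewrite scalerDr; apply: deg_sumD => //; apply/(deg_sum_base (k := k))/HZ.
Qed.

End HomogeneousSpan.

Section Endomorphisms.
Variables (K : fieldType) (V : gradedLmodType K).

(* Hom^k(V, V) *)
Definition end_deg (k : int) (f : V -> V) : Prop :=
  linear f /\ forall i v, v \in homog i -> f v \in homog (i + k).

(* End^*(V) = \bigoplus_k Hom^k(V, V) *)
Definition gend_pred : {pred V -> V} := fun f => `[< deg_sum end_deg f >].

Record gend := GEnd { gend_fun :> V -> V; _ : gend_fun \in gend_pred }.

HB.instance Definition _ := [isSub for gend_fun].
HB.instance Definition _ := [Choice of gend by <:].

Lemma homogZ i a (v : V) : v \in homog i -> a *: v \in homog i.
Proof. by move=> /eqP hv; apply/eqP; rewrite linearZ /= hv. Qed.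

Lemma end_degZ k a f : end_deg k f -> end_deg k (a *: f).
Proof.
move=> [lf hf]; split=> [b u v|i v /hf]; last exact: homogZ.
change (a *: f (b *: u + v) = b *: (a *: f u) + a *: f v).
by rewrite lf scalerDr !scalerA mulrC.
Qed.

Fact gend_closed : GRing.subsemimod_closed gend_pred.
Proof. exact: deg_sum_closed end_degZ. Qed.

HB.instance Definition _ :=
  GRing.SubChoice_isSubLmodule.Build K (V -> V) gend_pred gend gend_closed.

Lemma gend_linear (f : gend) : linear f.
Proof.
case: f => f /= /asboolP; elim/deg_sum_ind => [|k g h [lg _] lh] a x y.
  by change (0 = a *: 0 + 0 :> V); rewrite scaler0 addr0.
change (g (a *: x + y) + h (a *: x + y) = a *: (g x + h x) + (g y + h y)).
by rewrite lg lh scalerDr addrACA.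
Qed.

HB.instance Definition _ (f : gend) :=
  GRing.isLinear.Build K V V *:%R f (gend_linear f).

Fact gend_id_proof : (id : V -> V) \in gend_pred.
Proof.
by apply/asboolP/(deg_sum_base (k := 0)); split=> // i v; rewrite addr0.
Qed.

Definition gend_id : gend := GEnd gend_id_proof.

Fact gend_comp_proof (f g : gend) : (fun v => f (g v)) \in gend_pred.
Proof.
case: f g => f /asboolP Hf [g /asboolP Hg] /=; apply/asboolP.
elim/deg_sum_ind: Hf => [|k f1 f2 [lf1 hf1] Hf2]; first exact: deg_sum0.
apply: (@deg_sumD _ _ _ (fun v => f1 (g v)) (fun v => f2 (g v))) => //.
pose F := GRing.isLinear.Build K V V *:%R f1 lf1.
pose f1l : {linear V -> V} := HB.pack f1 F.
elim/deg_sum_ind: Hg => [|l g1 g2 [lg1 hg1] Hg2].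
  rewrite (_ : (fun v => _) = 0); first exact: deg_sum0.
  by apply/funext => v; apply: (linear0 f1l).
rewrite (_ : (fun v => _) = (fun v => f1 (g1 v)) + (fun v => f1 (g2 v))).
  apply: deg_sumD => //; apply: (deg_sum_base (k := l + k)); split.
    by move=> a u v; rewrite lg1 lf1.
  by move=> i v /hg1/hf1; rewrite addrA.
by apply/funext => v; apply: (linearD f1l).
Qed.

Definition gend_comp (f g : gend) : gend := GEnd (gend_comp_proof f g).

End Endomorphisms.

(* (-1)^(p q) *)
Definition dsign (K : fieldType) (p q : int) : K := (-1) ^+ absz (p * q).

Section Aff.
Variables (K : fieldType) (V : gradedLmodType K).

(* Aff^*(V), identified with V x End^*(V). *)
Definition aff : Type := (V * gend V)%type.
HB.instance Definition _ := GRing.Lmodule.on aff.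

Definition aff_vec (x : V) : aff := (x, 0).
Definition aff_end (f : gend V) : aff := (0, f).

Definition aff_deg (p : int) (u : aff) : Prop :=
  u.1 \in homog p /\ end_deg p u.2.

(* The bracket of u of degree p and w of degree q. *)
Definition aff_bracket (p q : int) (u w : aff) : aff :=
  (u.2 w.1 - dsign K p q *: w.2 u.1,
   gend_comp u.2 w.2 - dsign K p q *: gend_comp w.2 u.2).

(* The endomorphism v + t |-> f v + t x of V (+) K attached to (x, f); through
   it aff_bracket is the graded commutator. *)
Definition aff_map (u : aff) (z : V * K^o) : V * K^o :=
  (u.2 z.1 + (z.2 : K) *: u.1, 0).

Lemma aff_map_bracket p q u w z :
  aff_map (aff_bracket p q u w) z =
  aff_map u (aff_map w z) - dsign K p q *: aff_map w (aff_map u z).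
Proof.
case: u w z => [x f] [y g] [v t0]; pose t : K := t0.
rewrite /aff_map /aff_bracket /=.
congr (_, _).
  2: by change (0 = 0 - dsign K p q *: 0 :> K^o); rewrite scaler0 subr0.
change (f (g v) - dsign K p q *: g (f v) + t *: (f y - dsign K p q *: g x) =
  f (g v + t *: y) + 0 *: x - dsign K p q *: (g (f v + t *: x) + 0 *: y)).
have lin (h : gend V) a b c : h (b + a *: c) = h b + a *: h c.
  by rewrite addrC gend_linear addrC.
rewrite !scale0r !addr0 !lin.
rewrite scalerBr scalerDr opprD addrACA.
by rewrite !scalerA [t * _]mulrC.
Qed.

End Aff.

(* The Koszul sign: v_1 ... v_n = ksign s d v_(s 1) ... v_(s n) in the symmetric
   algebra when |v_i| = d i. An inversion of s at the places i < j exchanges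
   v_(s i) and v_(s j). *)
Definition ksign (K : fieldType) (n : nat) (s : 'S_n) (d : 'I_n -> int) : K :=
  (-1) ^+ #|[set ij : 'I_n * 'I_n |
    [&& (ij.1 < ij.2)%N, (s ij.2 < s ij.1)%N
      & odd (absz (d (s ij.1) * d (s ij.2)))]]|.

Section SymmetricOperators.
Variables (K : fieldType) (n : nat) (V : gradedLmodType K).
Implicit Types (f : {ffun 'I_n -> V} -> V) (v : {ffun 'I_n -> V}).

Definition upd v (i : 'I_n) (x : V) : {ffun 'I_n -> V} :=
  [ffun j => if j == i then x else v j].

Definition multilinear f : Prop :=
  forall v i a x y, f (upd v i (a *: x + y)) = a *: f (upd v i x) + f (upd v i y).

Definition has_degs (d : 'I_n -> int) v : Prop := forall i, v i \in homog (d i).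

Definition graded_symmetric f : Prop :=
  forall d v (s : 'S_n), has_degs d v ->
    f v = ksign K s d *: f [ffun i => v (s i)].

(* Hom^k(V^(.)n, V) *)
Definition op_deg (k : int) f : Prop :=
  [/\ multilinear f, graded_symmetric f
    & forall d v, has_degs d v -> f v \in homog (\sum_i d i + k)].

Definition symop_pred : {pred {ffun 'I_n -> V} -> V} :=
  fun f => `[< deg_sum op_deg f >].

(* symop n V is D_(n-1)(V) = Hom^*(V^(.)n, V); for n = 0 this is
   Hom^*(K, V) = V, a vector being identified with a nullary operator. *)
Record symop := SymOp {
  symop_fun :> {ffun 'I_n -> V} -> V; _ : symop_fun \in symop_pred }.

HB.instance Definition _ := [isSub for symop_fun].
HB.instance Definition _ := [Choice of symop by <:].

Lemma op_degZ k a f : op_deg k f -> op_deg k (a *: f).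
Proof.
move=> [lf sf hf]; split=> [v i b x y|d v s hv|d v /hf]; last exact: homogZ.
- change (a *: f (upd v i (b *: x + y)) =
    b *: (a *: f (upd v i x)) + a *: f (upd v i y)).
  by rewrite lf scalerDr !scalerA mulrC.
- change (a *: f v = ksign K s d *: (a *: f [ffun i => v (s i)])).
  by rewrite (sf _ _ s hv) !scalerA mulrC.
Qed.

Fact symop_closed : GRing.subsemimod_closed symop_pred.
Proof. exact: deg_sum_closed op_degZ. Qed.

HB.instance Definition _ := GRing.SubChoice_isSubLmodule.Build K
  ({ffun 'I_n -> V} -> V) symop_pred symop symop_closed.

End SymmetricOperators.

Section NijenhuisRichardson.
Variables (K : fieldType) (V : gradedLmodType K).

(* S(m, n): increasing on the first m and on the last n places. *)
Definition shuffles (m n : nat) : {set 'S_(m + n)} :=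
  [set s : 'S_(m + n) | [forall i : 'I_(m + n), forall j : 'I_(m + n),
    (i < j)%N && ((j < m)%N || (m <= i)%N) ==> (s i < s j)%N]].

Definition fcons n (x : V) (v : {ffun 'I_n -> V}) : {ffun 'I_n.+1 -> V} :=
  [ffun i => if unlift ord0 i is Some j then v j else x].

(* The product of an operator f with n + 1 arguments and an operator g with m
   arguments, at arguments v of degrees d. *)
Definition nr_prod (m n : nat) (f : symop n.+1 V) (g : symop m V)
    (d : 'I_(m + n) -> int) (v : {ffun 'I_(m + n) -> V}) : V :=
  \sum_(s in shuffles m n)
    ksign K s d *: f (fcons (g [ffun i => v (s (lshift n i))])
                            [ffun j => v (s (rshift m j))]).

(* The component with N arguments of the product of F, G in
   \prod_(n >= 0) D_(n-1)(V). Nullary components of F contribute 0. *)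
Definition nr_mul (F G : forall n, symop n V) (N : nat)
    (d : 'I_N -> int) (v : {ffun 'I_N -> V}) : V :=
  \sum_(m < N.+1)
    let e : (m + (N - m))%N = N := subnKC (leq_ord m) in
    nr_prod (F (N - m).+1) (G m)
      (fun i => d (cast_ord e i)) [ffun i => v (cast_ord e i)].

(* [F, G] for F, G of degrees p, q. *)
Definition nr_bracket (p q : int) (F G : forall n, symop n V) (N : nat)
    (d : 'I_N -> int) (v : {ffun 'I_N -> V}) : V :=
  nr_mul F G d v - dsign K p q *: nr_mul G F d v.

End NijenhuisRichardson.

Section Conditions.
Variable K : fieldType.

(* For each A, the components Psi^n : Aff^*(A) -> D_(n-1)(A) of a linear map
   Aff^*(A) -> D(A). *)
Definition psi_family : Type :=
  forall (A : gradedAlgType K) (n : nat), {linear aff A -> symop n A}.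

Variable Psi : psi_family.

Definition degree_preserving : Prop :=
  forall (A : gradedAlgType K) p (u : aff A), aff_deg p u ->
  forall n, op_deg p (Psi A n u).

Definition generalized_Jacobi : Prop :=
  forall (A : gradedAlgType K) p q (u w : aff A), aff_deg p u -> aff_deg q w ->
  forall n d (v : {ffun 'I_n -> A}), has_degs d v ->
  Psi A n (aff_bracket p q u w) v =
  nr_bracket p q (fun k => Psi A k u) (fun k => Psi A k w) d v.

Definition naturality : Prop :=
  forall (A B : gradedAlgType K) (alpha : A -> B), galg_morphism alpha ->
  forall (x : A) (f : gend A) (g : gend B),
  (forall a, g (alpha a) = alpha (f a)) ->
  forall n (v : {ffun 'I_n -> A}),
    alpha (Psi A n (aff_vec x) v) =
      Psi B n (aff_vec (alpha x)) [ffun i => alpha (v i)] /\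
    alpha (Psi A n (aff_end f) v) =
      Psi B n (aff_end g) [ffun i => alpha (v i)].

Definition base_change : Prop :=
  forall (A : gradedAlgType K) k (c : A), c \in homog k ->
  (forall i a, a \in homog i -> gmul a c = dsign K i k *: gmul c a) ->
  forall n (v : {ffun 'I_n.+1 -> A}),
  let vc := upd v ord_max (gmul (v ord_max) c) in
    Psi A n.+1 (aff_vec gone) vc = gmul (Psi A n.+1 (aff_vec gone) v) c /\
    Psi A n.+1 (aff_end (gend_id A)) vc =
      gmul (Psi A n.+1 (aff_end (gend_id A)) v) c.

Definition initial_terms : Prop :=
  forall (A : gradedAlgType K) (x : A) (f : gend A) (v : {ffun 'I_0 -> A}),
  Psi A 0 (aff_vec x) v = x /\ Psi A 0 (aff_end f) v = f gone.

Definition gauge_fixing : Prop :=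
  forall n, (0 < n)%N -> Psi K^o n (aff_end (gend_id K^o)) = 0.

Record higher_koszul : Prop := {
  hk_degree : degree_preserving;
  hk_Jacobi : generalized_Jacobi;
  hk_natural : naturality;
  hk_base_change : base_change;
  hk_initial : initial_terms;
  hk_gauge : gauge_fixing
}.

End Conditions.

(* Main.v *)
Require Import Defs.
From HB Require Import structures.
From mathcomp Require Import all_boot all_order all_fingroup all_algebra.
From mathcomp Require Import boolp functions.
From mathcomp Require Import zify.

Set Implicit Arguments.
Unset Strict Implicit.
Unset Printing Implicit Defensive.

Import GRing.Theory.
Local Open Scope ring_scope.

(* In generating form, Psi_(x, f)(a) = (d exp_a)^-1 (x + f (e^a)): the affine
   vector field (x, f), read in the coordinate e^a. With E the polarization of
   the series e^a, this says that Psi_u is the unique solution of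
   E /\ Psi_u = u o E, which is solved recursively on the number of arguments.
   The right-symmetry of the associator of /\ then gives
   E /\ [Psi_u, Psi_w] = [u, w] o E, whence the generalized Jacobi identity.
   If Y(a) commutes with a then E /\ Y = Y E, so Psi_Id = 1 and
   Psi_1(a) = e^(-a), which yields gauge fixing and base change.

   Conversely, a natural family of operators that is multilinear over the centre
   and vanishes on K vanishes: on the diagonal of degree 0 elements because K[X]
   is commutative, and then everywhere by expanding its values at a + c t in
   A[t]/(t^2), with t of degree -|c|. This determines Psi_Id, and then Psi_1
   since [Id, 1] = 1. Finally [x, 1] = 0, [Id, x] = x and [f, x] = f(x)
   determine the components of Psi_x and Psi_f inductively. *)

(** * Signed unshuffles *)

(** Why the exponential: on [K], Id is the Euler field z d/dz, and gauge fixing asks that it read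
    d/da in the new coordinate; so dz/da = z, and the initial terms give z(0) = 1.

    The obstacle is the bookkeeping of signs and arities. Operators therefore become functions on
    lists of vectors labelled by parity, and the sum over shuffles becomes the recursive [ush],
    whose coassociativity and cocommutativity replace all manipulation of permutations; insertion
    sort links it to [ksign] and [shuffles] once and for all. Labels presuppose homogeneous
    arguments, so general vectors and endomorphisms are split into even and odd parts.

    For uniqueness, diagonal values in degree 0 say nothing directly about arguments of other
    degrees. The factor t brings an argument to degree 0, t^2 = 0 keeps only the part linear in it,
    and base change takes t out again. *)

Section Sign.
Variable W : zmodType.
(** Signs are booleans rather than scalars: they compose by xor in any [zmodType], and a sign
    identity becomes a finite case analysis on parities. *)
Definition sg (b : bool) (w : W) : W := if b then - w else w.

Lemma sgK b c w : sg b (sg c w) = sg (b (+) c) w.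
Proof. by case: b c => [] []; rewrite /sg //= opprK. Qed.
Lemma sgD b v w : sg b (v + w) = sg b v + sg b w.
Proof. by case: b; rewrite /sg ?opprD. Qed.
Lemma sgN b w : sg b (- w) = - sg b w.
Proof. by case: b. Qed.
Lemma sgB b v w : sg b (v - w) = sg b v - sg b w.
Proof. by rewrite sgD sgN. Qed.
Lemma sg0 b : sg b 0 = 0.
Proof. by case: b; rewrite /sg ?oppr0. Qed.
End Sign.

Lemma sgZ (K : fieldType) (W : lmodType K) b k (w : W) : sg b (k *: w) = k *: sg b w.
Proof. by case: b; rewrite /sg ?scalerN. Qed.

Section Unshuffle.
Variables (T : Type) (lab : T -> bool).

Fixpoint parity (l : seq T) : bool :=
  if l is x :: l' then lab x (+) parity l' else false.

Lemma parity_cat l1 l2 : parity (l1 ++ l2) = parity l1 (+) parity l2.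
Proof. by elim: l1 => //= x l ->; rewrite addbA. Qed.

Lemma parity_rcons l x : parity (rcons l x) = lab x (+) parity l.
Proof. by rewrite -cats1 parity_cat /= addbF addbC. Qed.

Section Zmod.
Variable W : zmodType.
Implicit Types (F G : seq T -> seq T -> W) (l a b : seq T).

(* The coproduct of the graded symmetric coalgebra: the sum of F over the ways
   of splitting l into two subsequences, with Koszul signs. *)
Fixpoint ush l F : W :=
  if l is x :: l' then
    ush l' (fun a b => F (x :: a) b)
    + ush l' (fun a b => sg (lab x && parity a) (F a (x :: b)))
  else F [::] [::].

Lemma ush_congr l F G :
  (forall a b, (size a + size b)%N = size l -> parity a (+) parity b = parity l ->
    (forall P : pred T, all P l -> all P a && all P b) -> F a b = G a b) ->
  ush l F = ush l G.
Proof.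
elim: l F G => [|x l IHl] F G FG /=; first exact: FG.
congr (_ + _); apply: IHl => a b Hs Hp Ha.
  apply: FG => [||P] /=; rewrite ?addSn ?Hs -?addbA ?Hp //.
  by case/andP=> -> /Ha.
congr sg; apply: FG => [||P] /=; rewrite ?addnS ?Hs -?Hp //.
  by rewrite addbCA.
by case/andP=> -> /Ha.
Qed.

Lemma eq_ush l F G : (forall a b, F a b = G a b) -> ush l F = ush l G.
Proof. by move=> FG; apply: ush_congr. Qed.

Lemma ushD l F G : ush l (fun a b => F a b + G a b) = ush l F + ush l G.
Proof.
elim: l F G => [|x l IHl] F G //=.
rewrite IHl addrACA; congr (_ + _); rewrite -IHl.
by apply: eq_ush => a b; rewrite sgD.
Qed.

Lemma ush0 l : ush l (fun _ _ => 0) = 0.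
Proof.
elim: l => //= x l IHl; rewrite IHl add0r -[RHS]IHl.
by apply: eq_ush => a b; rewrite sg0.
Qed.

Lemma ushN l F : ush l (fun a b => - F a b) = - ush l F.
Proof.
by apply/eqP; rewrite -addr_eq0 -ushD (eq_ush l (G := fun _ _ => 0)) ?ush0 // => a b;
  rewrite addNr.
Qed.

Lemma ush_sg l F c : ush l (fun a b => sg c (F a b)) = sg c (ush l F).
Proof. by case: c => //; apply: ushN. Qed.

Lemma ush_eq0 l F : (forall a b, (size a + size b)%N = size l -> F a b = 0) ->
  ush l F = 0.
Proof. by move=> F0; rewrite -[RHS](ush0 l); apply: ush_congr => a b Hs _ _; apply: F0. Qed.

Lemma ush_sum l (I : Type) (r : seq I) (F : I -> seq T -> seq T -> W) :
  ush l (fun a b => \sum_(i <- r) F i a b) = \sum_(i <- r) ush l (F i).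
Proof.
elim: r => [|i r IHr]; first by rewrite big_nil (eq_ush l (G := fun _ _ => 0)) ?ush0 // => a
  b; rewrite big_nil.
by rewrite big_cons -IHr -ushD; apply: eq_ush => a b; rewrite big_cons.
Qed.

(** Both sides split [l] into three parts. The head joins one of them, and on joining the last it
    passes the first two, whose parities add. *)
Lemma ush_coassoc l (F : seq T -> seq T -> seq T -> W) :
  ush l (fun a b => ush a (fun a1 a2 => F a1 a2 b)) =
  ush l (fun a b => ush b (fun b1 b2 => F a b1 b2)).
Proof.
elim: l F => [|x l IHl] F //=.
rewrite ushD (IHl (fun a1 => F (x :: a1))) -addrA; congr (_ + _).
rewrite (IHl (fun a1 a2 b => sg (lab x && parity a1) (F a1 (x :: a2) b))).
under [X in _ = X]eq_ush => a b do rewrite sgD -!ush_sg.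
rewrite [RHS]ushD; congr (_ + _).
under [X in X = _]eq_ush => a b do rewrite -!ush_sg.
rewrite -(IHl (fun a b1 b2 => sg (lab x && parity a) (sg (lab x && parity b1) (F a b1 (x ::
  b2))))).
apply: eq_ush => a b; apply: ush_congr => a1 a2 _ <- _.
by rewrite sgK -andb_addr.
Qed.

Lemma ush_cocomm l F :
  ush l F = ush l (fun a b => sg (parity a && parity b) (F b a)).
Proof.
elim: l F => [|x l IHl] F //=; rewrite addrC; congr (_ + _).
  rewrite IHl; apply: eq_ush => a b; rewrite !sgK; congr sg.
  by case: (lab x) (parity a) (parity b) => [] [] [].
rewrite IHl; apply: eq_ush => a b; rewrite !sgK; congr sg.
by case: (lab x) (parity a) (parity b) => [] [] [].
Qed.

Lemma ush_rcons l x F :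
  ush (rcons l x) F =
  ush l (fun a b => F a (rcons b x))
  + ush l (fun a b => sg (lab x && parity b) (F (rcons a x) b)).
Proof.
elim: l F => [|y l IHl] F /=; first by rewrite !andbF /= addrC.
rewrite !IHl addrACA; congr (_ + (_ + _)).
apply: eq_ush => a b; rewrite !sgK parity_rcons; congr sg.
by case: (lab x) (lab y) (parity a) (parity b) => [] [] [] [].
Qed.

(** Isolates the splitting with nothing on the right. In [lop_nr] it is the only term whose inner
    operator receives all arguments, hence the pivot of the recursion that defines [psi]. *)
Lemma ush_split_last l F :
  ush l F = F l [::] + ush l (fun a b => if nilp b then 0 else F a b).
Proof.
elim: l F => [|x l IHl] F /=; first by rewrite addr0.
rewrite IHl -addrA; congr (_ + _); congr (_ + _).
Qed.

Lemma ush_split_first l F :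
  ush l F = F [::] l + ush l (fun a b => if nilp a then 0 else F a b).
Proof.
elim: l F => [|x l IHl] F /=; first by rewrite addr0.
rewrite addrC IHl /= andbF -addrA /=; congr (_ + _); rewrite addrC; congr (_ + _).
by apply: eq_ush => a b; case: ifP; rewrite ?sg0.
Qed.

(** Adjacent exchanges suffice: [gsym_sort] recovers the Koszul sign of any rearrangement. *)
Definition gsym (F : seq T -> W) : Prop := forall l1 x y l2,
  F (l1 ++ x :: y :: l2) = sg (lab x && lab y) (F (l1 ++ y :: x :: l2)).

(** If [x] and [y] fall in the same part, the symmetry of [F] applies; otherwise their exchange
    permutes the two mixed terms, whose signs differ by [lab x && lab y]. *)
Lemma ush_gsym F : (forall b, gsym (F^~ b)) -> (forall a, gsym (F a)) ->
  gsym (fun l => ush l F).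
Proof.
move=> Fl Fr l1 x y l2; elim: l1 F Fl Fr => [|z l1 IHl] F Fl Fr /=.
  rewrite !sgD -!ush_sg -!addrA; congr (_ + _).
    by apply: eq_ush => a b; exact: (Fl b [::]).
  rewrite addrCA; congr (_ + (_ + _)); apply: eq_ush => a b; rewrite ?sgK.
  - by congr sg; case: (lab x) (lab y) (parity a) => [] [] [].
  - by congr sg; case: (lab x) (lab y) (parity a) => [] [] [].
  - rewrite (Fr a [::] x y b) sgK; congr sg.
    by case: (lab x) (lab y) (parity a) => [] [] [].
rewrite sgD; congr (_ + _); apply: IHl => [b|a] l3 u v l4.
- exact: (Fl b (z :: l3)).
- exact: Fr.
- rewrite Fl !sgK !parity_cat /=; congr sg.
  by case: (lab z) (lab u) (lab v) (parity l3) (parity l4) => [] [] [] [] [].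
- by rewrite (Fr a (z :: l3)) !sgK addbC.
Qed.

(** The Koszul sign of extracting an entry is the cost of moving it back to its place, so each
    extraction contributes [F l]. This yields the integer factor that characteristic 0 cancels when
    [Psi_x] is determined. *)
Lemma ush_single l (F : seq T -> W) : gsym F ->
  ush l (fun a b => if a is [:: y] then F (y :: b) else 0) = F l *+ size l.
Proof.
elim: l F => [|x l IHl] F Fs /=; first by rewrite mulr0n.
rewrite mulrS; congr (_ + _).
  by rewrite ush_split_first /= ush_eq0 ?addr0 // => [[|u a]] b.
transitivity (ush l (fun a b => if a is [:: y] then F (x :: y :: b) else 0)).
  apply: eq_ush => [[|y [|z a]]] b; rewrite ?sg0 //=.
  by rewrite addbF (Fs [::] x y).
by rewrite (IHl (fun l => F (x :: l))) // => l1; apply: (Fs (x :: l1)).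
Qed.

End Zmod.

Lemma ushZ (K : fieldType) (W : lmodType K) k l (F : seq T -> seq T -> W) :
  ush l (fun a b => k *: F a b) = k *: ush l F.
Proof.
elim: l F => [|x l IHl] F //=; rewrite scalerDr -!IHl; congr (_ + _).
by apply: eq_ush => a b; rewrite sgZ.
Qed.

Lemma ush_additive (W W' : zmodType) (h : {additive W -> W'}) l F :
  h (ush l F) = ush l (fun a b => h (F a b)).
Proof.
elim: l F => [|x l IHl] F //=; rewrite raddfD !IHl; congr (_ + _).
by apply: eq_ush => a b; case: (_ && _); rewrite /sg ?raddfN.
Qed.

End Unshuffle.

Lemma parity_map (T U : Type) (lab : T -> bool) (labU : U -> bool) (h : U -> T) l :
  (forall u, lab (h u) = labU u) -> parity lab (map h l) = parity labU l.
Proof. by move=> Hh; elim: l => //= x l ->; rewrite Hh. Qed.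

Lemma ush_map (T U : Type) (lab : T -> bool) (labU : U -> bool) (W : zmodType)
  (h : U -> T) l (F : seq T -> seq T -> W) : (forall u, lab (h u) = labU u) ->
  ush lab (map h l) F = ush labU l (fun a b => F (map h a) (map h b)).
Proof.
move=> Hh; elim: l F => [|x l IHl] F //=; rewrite !IHl Hh; congr (_ + _).
by apply: eq_ush => a b; rewrite (parity_map _ Hh).
Qed.

Lemma gsym_move (T : Type) (lab : T -> bool) (W : zmodType) (F : seq T -> W) l1 x r1 r2 :
  gsym lab F ->
  F (l1 ++ x :: r1 ++ r2) = sg (lab x && parity lab r1) (F (l1 ++ r1 ++ x :: r2)).
Proof.
move=> Fs; elim: r1 l1 => [|y r1 IHr] l1 /=; first by rewrite andbF.
rewrite Fs -cat_rcons IHr cat_rcons sgK; congr sg.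
by case: (lab x) (lab y) (parity lab r1) => [] [] [].
Qed.

(** * Operators on lists and the exponential *)

Section GradedAlgebraTheory.
Variables (K : fieldType) (A : gradedAlgType K).
Implicit Types (x y z : A) (k : K).

HB.instance Definition _ x :=
  GRing.isLinear.Build K A A *:%R (gmul x) (gmul_linearr x).

Definition gmulr y x := gmul x y.
HB.instance Definition _ y :=
  GRing.isLinear.Build K A A *:%R (gmulr y) (gmul_linearl y).

Lemma gmulDr x y z : gmul x (y + z) = gmul x y + gmul x z.
Proof. exact: linearD. Qed.
Lemma gmulDl x y z : gmul (x + y) z = gmul x z + gmul y z.
Proof. exact: (linearD (gmulr z)). Qed.
Lemma gmulZr x k y : gmul x (k *: y) = k *: gmul x y.
Proof. exact: linearZ. Qed.
Lemma gmulZl x k y : gmul (k *: x) y = k *: gmul x y.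
Proof. exact: (linearZ_LR (gmulr y)). Qed.
Lemma gmul0l x : gmul 0 x = 0.
Proof. exact: (linear0 (gmulr x)). Qed.
Lemma gmul0r x : gmul x 0 = 0.
Proof. exact: linear0. Qed.
Lemma gmulBl x y z : gmul (x - y) z = gmul x z - gmul y z.
Proof. exact: (linearB (gmulr z)). Qed.
Lemma gmul_sgr x b y : gmul x (sg b y) = sg b (gmul x y).
Proof. by case: b => //; apply: linearN. Qed.
Lemma gmul_sgl x b y : gmul (sg b x) y = sg b (gmul x y).
Proof. by case: b => //; apply: (linearN (gmulr y)). Qed.
Lemma gmul_ushr x (T : Type) (lab : T -> bool) l F :
  gmul x (ush lab l F) = ush lab l (fun a b => gmul x (F a b)).
Proof. exact: ush_additive. Qed.
Lemma gmul_ushl x (T : Type) (lab : T -> bool) l F :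
  gmul (ush lab l F) x = ush lab l (fun a b => gmul (F a b) x).
Proof. exact: (ush_additive lab (gmulr x)). Qed.

End GradedAlgebraTheory.

(* Multilinear operators of all arities, whose arguments are homogeneous
   vectors paired with their parities. *)
Definition lop (K : fieldType) (V : lmodType K) : Type := seq (bool * V) -> V.

Section ListOperators.
Variables (K : fieldType) (V : lmodType K).
HB.instance Definition _ := GRing.Lmodule.on (lop V).
Implicit Types (F G H : lop V) (l : seq (bool * V)).

Notation lab := (@fst bool V).
Notation par := (parity lab).
Notation lush := (ush lab).

(** The label is not tied to the vector: at a fixed label every vector is allowed, so linearity
    needs no homogeneity condition. *)
Definition mlin F : Prop := forall l1 b k x y l2,
  F (l1 ++ (b, k *: x + y) :: l2) =
  k *: F (l1 ++ (b, x) :: l2) + F (l1 ++ (b, y) :: l2).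

Lemma mlin0 F l1 b l2 : mlin F -> F (l1 ++ (b, 0) :: l2) = 0.
Proof.
move=> Fl; have:= Fl l1 b 1 0 0 l2; rewrite scale1r addr0 scale1r.
by move/eqP; rewrite -subr_eq0 opprD addNKr oppr_eq0 => /eqP.
Qed.

Lemma mlinZ F l1 b k x l2 :
  mlin F -> F (l1 ++ (b, k *: x) :: l2) = k *: F (l1 ++ (b, x) :: l2).
Proof. by move=> Fl; rewrite -[k *: x]addr0 Fl mlin0 ?addr0. Qed.

Lemma mlin_sg F l1 b c x l2 :
  mlin F -> F (l1 ++ (b, sg c x) :: l2) = sg c (F (l1 ++ (b, x) :: l2)).
Proof. by move=> Fl; case: c; rewrite // /sg -scaleN1r mlinZ // scaleN1r. Qed.

Lemma mlin_linear F l1 b l2 : mlin F -> linear (fun x => F (l1 ++ (b, x) :: l2)).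
Proof. by move=> Fl k x y; rewrite Fl. Qed.

Lemma mlin_ush F l1 b (T : Type) (labT : T -> bool) t (G : seq T -> seq T -> V) l2 : mlin F ->
  F (l1 ++ (b, ush labT t G) :: l2) =
  ush labT t (fun u v => F (l1 ++ (b, G u v) :: l2)).
Proof.
move=> Fl; pose M := GRing.isLinear.Build K V V *:%R _ (mlin_linear l1 b l2 Fl).
pose h : {linear V -> V} := HB.pack (fun x => F (l1 ++ (b, x) :: l2)) M.
exact: (ush_additive labT h).
Qed.

Lemma ush_mlin (F : seq (bool * V) -> seq (bool * V) -> V) :
  (forall b, mlin (F^~ b)) -> (forall a, mlin (F a)) -> mlin (fun l => lush l F).
Proof.
move=> Fl Fr l1 c k x y l2; elim: l1 F Fl Fr => [|z l1 IHl] F Fl Fr /=.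
  rewrite scalerDr addrACA; congr (_ + _); rewrite -ushZ -ushD; apply: eq_ush => a b.
    exact: (Fl b [::]).
  by rewrite (Fr a [::]) sgD sgZ.
rewrite scalerDr addrACA; congr (_ + _); apply: IHl => [b|a] l3 d m u v l4.
- exact: (Fl b (z :: l3)).
- exact: Fr.
- by rewrite Fl !parity_cat sgD sgZ.
- by rewrite (Fr a (z :: l3)) sgD sgZ.
Qed.

(* The Nijenhuis-Richardson product F /\ G for an operator G of parity q. *)
Definition lop_nr (q : bool) F G : lop V := fun l =>
  lush l (fun a b => F ((par a (+) q, G a) :: b)).

(** The polarized second derivative of [F] along [G] and [H]: they fill separate slots of [F], and
    the sign pays for moving [H a] behind the arguments [b1] of [G]. *)
Definition lop_assoc (q r : bool) F G H : lop V := fun l =>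
  lush l (fun a b => lush b (fun b1 b2 => sg ((par a (+) r) && par b1)
    (F ((par b1 (+) q, G b1) :: (par a (+) r, H a) :: b2)))).

(** In [(F /\ G) /\ H] the value of [H] becomes either an argument of [G], which gives
    [F /\ (G /\ H)], or one of [F], which gives the associator. Splitting a list with head [H a]
    computes to these two sums. *)
Lemma lop_nrA q r F G H : mlin F ->
  lop_nr r (lop_nr q F G) H = lop_nr (q (+) r) F (lop_nr r G H) + lop_assoc q r F G H.
Proof.
move=> Fl; apply/funext => l.
transitivity (lush l (fun a b => lush b (fun c d =>
    F ((par a (+) r (+) par c (+) q, G ((par a (+) r, H a) :: c)) :: d)))
  + lop_assoc q r F G H l); first by rewrite -ushD.
rewrite -ush_coassoc; congr (_ + _); apply: eq_ush => a b.
rewrite (mlin_ush [::]) //; apply: ush_congr => a1 a2 _ <- _ /=.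
by congr (F ((_, _) :: _)); rewrite -!addbA; congr addb; rewrite addbCA [r (+) q]addbC.
Qed.

(** By coassociativity and cocommutativity [a] and [b1] trade roles; the symmetry of [F] then
    exchanges its first two slots. *)
Lemma lop_assocC q r F G H l : gsym lab F ->
  lop_assoc q r F G H l = sg (q && r) (lop_assoc r q F H G l).
Proof.
move=> Fs; rewrite /lop_assoc -!ush_coassoc -ush_sg; apply: eq_ush => c b2.
rewrite -ush_sg [RHS]ush_cocomm; apply: eq_ush => a b1.
rewrite (Fs [::]) !sgK /=; congr sg.
by case: (par a) (par b1) q r => [] [] [] [].
Qed.

End ListOperators.

(** * The convolution ring of operators and its exponential *)

Section Convolution.
Variables (K : fieldType) (A : gradedAlgType K).
Implicit Types (F G H Y : lop A) (l : seq (bool * A)).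
Notation lab := (@fst bool A).
Notation par := (parity lab).
Notation lush := (ush lab).

Definition conv_one : lop A := fun l => if l is [::] then gone else 0.
(** The polarization of the pointwise product [F(a) G(a)] of generating functions, dual to the
    coproduct [ush]. *)
Definition conv_mul F G : lop A := fun l => lush l (fun a b => gmul (F a) (G b)).

Fact conv_mulA : associative conv_mul.
Proof.
move=> F G H; apply/funext => l; rewrite /conv_mul.
under eq_ush => a b do rewrite gmul_ushr.
rewrite -ush_coassoc; apply: eq_ush => a b; rewrite gmul_ushl.
by apply: eq_ush => a1 a2; rewrite gmulA.
Qed.

Fact conv_mul1l : left_id conv_one conv_mul.
Proof.
move=> F; apply/funext => l; rewrite /conv_mul ush_split_first gmul1l ush_eq0 ?addr0 //.
by case=> [|x a] b //= _; rewrite gmul0l.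
Qed.

Fact conv_mul1r : right_id conv_one conv_mul.
Proof.
move=> F; apply/funext => l; rewrite /conv_mul ush_split_last gmul1r ush_eq0 ?addr0 //.
by move=> a [|x b] //= _; rewrite gmul0r.
Qed.

Fact conv_mulDl : left_distributive conv_mul +%R.
Proof.
move=> F G H; apply/funext => l; rewrite -[RHS]/(lush l _ + lush l _) -ushD.
by apply: eq_ush => a b; rewrite -gmulDl.
Qed.

Fact conv_mulDr : right_distributive conv_mul +%R.
Proof.
move=> F G H; apply/funext => l; rewrite -[RHS]/(lush l _ + lush l _) -ushD.
by apply: eq_ush => a b; rewrite -gmulDr.
Qed.

HB.instance Definition _ := GRing.Zmodule_isPzRing.Build (lop A)
  conv_mulA conv_mul1l conv_mul1r conv_mulDl conv_mulDr.

Lemma lopE F G l : (F * G) l = lush l (fun a b => gmul (F a) (G b)).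
Proof. by []. Qed.

Lemma lopDE F G l : (F + G) l = F l + G l.
Proof. by []. Qed.

(** The polarization of [a |-> a]; so [iota1 ^+ n] is that of [a^n], the signed sum of the products
    of [n] arguments in all orders. *)
Definition iota1 : lop A := fun l => if l is [:: x] then x.2 else 0.

Lemma iotaX_size n l : size l != n -> (iota1 ^+ n) l = 0.
Proof.
elim: n l => [|n IHn] l ns; first by case: l ns.
rewrite exprS lopE ush_eq0 // => [[|x [|y a]]] b /= Hs; rewrite ?gmul0l //.
by rewrite IHn ?gmul0r //; move: ns; rewrite -Hs add1n.
Qed.

Lemma gsym_conv_mul F G : gsym lab F -> gsym lab G -> gsym lab (F * G).
Proof.
move=> Fs Gs; apply: (ush_gsym (F := fun a b => gmul (F a) (G b))) => [b|a] l1 x y l2.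
  by rewrite Fs gmul_sgl.
by rewrite Gs gmul_sgr.
Qed.

Lemma mlin_conv_mul F G : mlin F -> mlin G -> mlin (F * G).
Proof.
move=> Fl Gl; apply: (ush_mlin (F := fun a b => gmul (F a) (G b))) => [b|a] l1 c k x y l2.
  by rewrite Fl gmulDl gmulZl.
by rewrite Gl gmulDr gmulZr.
Qed.

Lemma gsym_iotaX n : gsym lab (iota1 ^+ n).
Proof.
elim: n => [|n IHn]; first by move=> [|? ?] x y l2; rewrite /= sg0.
rewrite exprS; apply: gsym_conv_mul => // l1 x y l2.
by case: l1 => [|? [|? ?]]; rewrite /= sg0.
Qed.

Lemma mlin_iotaX n : mlin (iota1 ^+ n).
Proof.
elim: n => [|n IHn]; first by move=> [|? ?] b k x y l2 /=; rewrite scaler0 addr0.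
rewrite exprS; apply: mlin_conv_mul => // l1 b k x y l2.
by case: l1 l2 => [|? [|? ?]] [|? ?] //=; rewrite scaler0 addr0.
Qed.

(* The exponential of iota1, i.e. the polarization of the series e^a. *)
Definition sexp : lop A := fun l => (size l)`!%:R^-1 *: (iota1 ^+ size l) l.

(** Trades the exponent [size l], which varies with the splitting, for a fixed range of summation
    that can be exchanged with [ush]. *)
Lemma sexp_sum M l : (size l < M)%N ->
  sexp l = \sum_(n < M) n`!%:R^-1 *: (iota1 ^+ n) l.
Proof.
move=> lM; rewrite (bigD1 (Ordinal lM)) //= big1 ?addr0 // => i ne.
by rewrite iotaX_size ?scaler0 // eq_sym; apply: contra ne => /eqP e; apply/eqP/val_inj.
Qed.

Lemma gsym_sexp : gsym lab sexp.
Proof.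
move=> l1 x y l2; by rewrite /sexp !size_cat gsym_iotaX sgZ.
Qed.

Lemma mlin_sexp : mlin sexp.
Proof.
move=> l1 b k x y l2; rewrite /sexp mlin_iotaX !size_cat /= scalerDr !scalerA.
by rewrite [k * _]mulrC.
Qed.

Lemma sexp0 : sexp [::] = gone.
Proof. by rewrite /sexp expr0 invr1 scale1r. Qed.

Lemma sexp1 x : sexp [:: x] = x.2.
Proof. by rewrite /sexp expr1 invr1 scale1r. Qed.

(** Inserting an even operator is a derivation. The list is cut in three, for [Y], [F] and [G];
    cocommutativity carries the arguments of [Y] across those of [F], and an even [Y] adds no sign
    of its own. *)
Lemma lop_nr_conv F G Y :
  lop_nr false (F * G) Y = lop_nr false F Y * G + F * lop_nr false G Y.
Proof.
apply/funext => l; rewrite lopDE !lopE /lop_nr.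
under [X in _ = X + _]eq_ush => a b do rewrite gmul_ushl.
under [X in _ = _ + X]eq_ush => a b do rewrite gmul_ushr.
rewrite [X in _ = X + _](ush_coassoc lab l (fun a1 a2 b => gmul (F ((par a1 (+) false, Y a1)
  :: a2)) (G b))).
rewrite -(ush_coassoc lab l (fun a b1 b2 => gmul (F a) (G ((par b1 (+) false, Y b1) :: b2)))).
under [X in _ = _ + X]eq_ush => a b do rewrite ush_cocomm.
rewrite (ush_coassoc lab l (fun a1 a2 b => sg _ (gmul _ (G (_ :: b))))) -ushD.
apply: eq_ush => a b; rewrite lopE /=; congr (_ + _).
by apply: eq_ush => b1 b2; rewrite addbF.
Qed.

Lemma lop_nr_iota1 Y : lop_nr false iota1 Y = Y.
Proof.
apply/funext => l; rewrite /lop_nr ush_split_last /= ush_eq0 ?addr0 //.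
by move=> a [|x b].
Qed.

Lemma lop_nr_iotaX n Y : Y * iota1 = iota1 * Y ->
  lop_nr false (iota1 ^+ n.+1) Y = (Y * iota1 ^+ n) *+ n.+1.
Proof.
move=> YC; elim: n => [|n IHn]; first by rewrite expr1 lop_nr_iota1 expr0 mulr1.
rewrite exprS lop_nr_conv lop_nr_iota1 IHn mulrnAr mulrA -YC -mulrA -exprS.
by rewrite [RHS]mulrS.
Qed.

End Convolution.

Section Exponential.
Variables (K : fieldType) (charK : [pchar K] =i pred0) (A : gradedAlgType K).
Implicit Types (F G H Y : lop A) (l : seq (bool * A)).
Notation lab := (@fst bool A).
Notation par := (parity lab).
Notation lush := (ush lab).
Notation sexp := (@sexp K A).
Notation iota1 := (@iota1 K A).

Lemma char0_natf_neq0 n : (0 < n)%N -> n%:R != 0 :> K.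
Proof. by move=> n0; have /pcharf0P -> := charK; rewrite -lt0n. Qed.

Lemma fact_neq0 n : n`!%:R != 0 :> K.
Proof. exact/char0_natf_neq0/fact_gt0. Qed.

(* dexp_a(Y(a)) = Y(a) e^a when Y(a) commutes with a. *)
Lemma lop_nr_sexp Y : Y * iota1 = iota1 * Y -> lop_nr false sexp Y = Y * sexp.
Proof.
move=> YC; apply/funext => l; rewrite /lop_nr lopE.
under [LHS]ush_congr => a b Hs _ _.
  have M1 : (size b < (size l).+1)%N by rewrite ltnS -Hs leq_addl.
  (* Inserting [Y a] lengthens [b] by one, so the range is one longer than on the right. The term of
     exponent 0 vanishes on a nonempty list, and dropping it realigns the two sums. *)
  rewrite (sexp_sum (M := (size l).+2)) //.
  rewrite big_ord_recl /= iotaX_size // scaler0 add0r; over.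
under [RHS]ush_congr => a b Hs _ _.
  have M1 : (size b < (size l).+1)%N by rewrite ltnS -Hs leq_addl.
  rewrite (sexp_sum M1).
  rewrite linear_sum; over.
rewrite !ush_sum; apply: eq_bigr => i _ /=.
have /(congr1 (fun F => F l)) := lop_nr_iotaX i YC.
rewrite ushZ /lop_nr => ->.
under [RHS]eq_ush => a b do rewrite gmulZr.
rewrite ushZ -lopE (_ : (_ *+ _) l = (Y * iota1 ^+ i) l *+ i.+1); last first.
  by elim: (i.+1) => // k IHk; rewrite mulrS lopDE IHk mulrS.
rewrite factS -scaler_nat scalerA natrM.
by rewrite invfM mulrAC mulVf ?mul1r // char0_natf_neq0.
Qed.

(** The case [Y = 1] of [lop_nr_sexp]. The head is described by equations so that rewriting also
    applies to heads that merely compute to the unit with even label. *)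
Lemma sexp_cons1 b x l : gone = x -> b = false -> sexp ((b, x) :: l) = sexp l.
Proof.
move=> <- ->; have := lop_nr_sexp (Y := 1); rewrite mul1r mulr1 => /(_ erefl).
move=> /(congr1 (fun F => F l)); rewrite mul1r => <-.
by rewrite /lop_nr ush_split_first /= ush_eq0 ?addr0 // => [[|x' a] c _] //=;
  apply: (mlin0 [::] _ c (@mlin_sexp K A)).
Qed.

Definition sexpN : lop A := fun l => (-1) ^+ size l *: sexp l.

Lemma sexpN_iota : sexpN * iota1 = iota1 * sexpN.
Proof.
apply/funext => l; rewrite !lopE.
(* As [iota1] takes one argument, [sexpN] takes [(size l).-1], and both products are its coefficient
   times a power of [iota1]. For empty [l] the exponent is 1 and everything is 0. *)
transitivity ((-1) ^+ (size l).-1 / (size l).-1`!%:R *: (iota1 ^+ (size l).-1.+1) l).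
  rewrite exprSr lopE -ushZ; apply: ush_congr => a [|x [|y b]] Hs _ _;
    rewrite ?gmul0r ?scaler0 //.
  by rewrite -Hs addn1 /= /sexpN /sexp !gmulZl scalerA.
rewrite exprS lopE -ushZ; apply: ush_congr => [[|x [|y a]]] b Hs _ _;
  rewrite ?gmul0l ?scaler0 //.
by rewrite -Hs add1n /= /sexpN /sexp !gmulZr scalerA.
Qed.

(** On [n] arguments the coefficient is the alternating sum of binomials [(1 - 1)^n], which is 1 for
    [n = 0] and 0 otherwise. *)
Lemma sexpN_sexp : sexpN * sexp = 1.
Proof.
apply/funext => l; set n := size l.
(* Only [i = size a] contributes. Written as a sum, the coefficients no longer depend on the
   splitting, and the two powers multiply to [iota1 ^+ n]. *)
have term a b : (size a + size b)%N = n ->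
    gmul (sexpN a) (sexp b) =
    \sum_(i < n.+1) ((-1) ^+ i / i`!%:R / (n - i)`!%:R) *:
      gmul ((iota1 ^+ i) a) ((iota1 ^+ (n - i)) b).
  move=> Hs; have an : (size a < n.+1)%N by rewrite ltnS -Hs leq_addr.
  rewrite (bigD1 (Ordinal an)) //= big1 ?addr0 => [|i ne]; last first.
    rewrite iotaX_size ?gmul0l ?scaler0 // eq_sym.
    by apply: contra ne => /eqP e; apply/eqP/val_inj.
  have -> : (n - size a)%N = size b by rewrite -Hs addKn.
  by rewrite /sexpN /sexp gmulZl gmulZl gmulZr !scalerA ?mulrA.
rewrite lopE; under ush_congr => a b Hs _ _ do rewrite term //.
rewrite ush_sum.
transitivity (\sum_(i < n.+1) ((-1) ^+ i *+ 'C(n, i)) *: (n`!%:R^-1 *: (iota1 ^+ n) l)).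
  apply: eq_bigr => i _; rewrite ushZ -lopE -exprD subnKC ?leq_ord // scalerA.
  congr (_ *: _); rewrite -[_ *+ 'C(_, _)]mulr_natr -!mulrA; congr (_ * _).
  apply: (mulfI (fact_neq0 i)); rewrite mulrA divff ?fact_neq0 // mul1r.
  apply: (mulfI (fact_neq0 (n - i))); rewrite divff ?fact_neq0 //.
  rewrite !mulrA -!natrM.
  have -> : ((n - i)`! * i`! * 'C(n, i) = n`!)%N.
    by rewrite -(bin_fact (leq_ord i)); lia.
  by rewrite divff ?fact_neq0.
rewrite -scaler_suml.
have -> : \sum_(i < n.+1) ((-1) ^+ i *+ 'C(n, i)) = (n == 0%N)%:R :> K.
  rewrite -expr0n -[X in X ^+ n](subrr 1) exprDn.
  by apply: eq_bigr => i _; rewrite expr1n mul1r.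
rewrite /n; case: (l) => [|x l'] /=; last by rewrite scale0r.
by rewrite expr0 invr1 !scale1r.
Qed.

Lemma lop_nr_sexp_sexpN : lop_nr false sexp sexpN = 1.
Proof. by rewrite (lop_nr_sexp sexpN_iota) sexpN_sexp. Qed.

End Exponential.

Section LinearMaps.
Variables (K : fieldType) (V W : lmodType K) (f : V -> W) (lf : linear f).

Definition linear_pack : {linear V -> W} :=
  HB.pack f (GRing.isLinear.Build K V W *:%R f lf).

Lemma lin0 : f 0 = 0.
Proof. exact: (linear0 linear_pack). Qed.
Lemma linD x y : f (x + y) = f x + f y.
Proof. exact: (linearD linear_pack). Qed.
Lemma linN x : f (- x) = - f x.
Proof. exact: (linearN linear_pack). Qed.
Lemma linB x y : f (x - y) = f x - f y.
Proof. exact: (linearB linear_pack). Qed.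
Lemma linZ k x : f (k *: x) = k *: f x.
Proof. exact: (linearZ_LR linear_pack). Qed.
Lemma lin_sum I (r : seq I) (P : pred I) (F : I -> V) :
  f (\sum_(i <- r | P i) F i) = \sum_(i <- r | P i) f (F i).
Proof. exact: (linear_sum linear_pack). Qed.
Lemma lin_sg b x : f (sg b x) = sg b (f x).
Proof. by case: b => //; apply: linN. Qed.
Lemma lin_ush (T : Type) (lab : T -> bool) l F :
  f (ush lab l F) = ush lab l (fun a b => f (F a b)).
Proof. exact: (ush_additive lab linear_pack). Qed.
End LinearMaps.

(** * Recursive solution of the equation for [psi] *)

Section Psi.
Variables (K : fieldType) (charK : [pchar K] =i pred0) (A : gradedAlgType K).
Implicit Types (F G H : lop A) (l : seq (bool * A)) (p q : bool) (x y : A).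
Implicit Types (f g : A -> A).
Notation lab := (@fst bool A).
Notation par := (parity lab).
Notation lush := (ush lab).
Notation sexp := (@sexp K A).

Lemma lop_nr_linearr p F : mlin F -> linear (lop_nr p F).
Proof.
move=> Fl k G H; apply/funext => l.
rewrite -[RHS]/(k *: lop_nr p F G l + lop_nr p F H l) /lop_nr -ushZ -ushD.
by apply: eq_ush => a b; exact: (Fl [::]).
Qed.

(** Triangularity: the leading term is [F l], because [sexp] of one argument is that argument, and
    the other terms involve [F] on shorter lists only. *)
Lemma lop_nr_sexpE p F l :
  lop_nr p sexp F l =
  F l + lush l (fun a b => if nilp b then 0 else sexp ((par a (+) p, F a) :: b)).
Proof. by rewrite /lop_nr ush_split_last sexp1. Qed.

Lemma lop_nr_sexp_inj p F G : lop_nr p sexp F = lop_nr p sexp G -> F = G.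
Proof.
move=> FG; apply/funext => l.
have [n] := ubnP (size l); elim: n l => // n IHn l; rewrite ltnS => ln.
have /(congr1 (fun F => F l)) := FG; rewrite !lop_nr_sexpE => E.
apply: (addIr (lush l (fun a b => if nilp b then 0 else sexp ((par a (+) p, F a) :: b)))).
rewrite E; congr (_ + _); apply: ush_congr => a b Hs _ _; case: ifP => // b0.
rewrite IHn // (leq_trans _ ln) // -Hs -addn1 leq_add2l.
by case: b b0 {Hs}.
Qed.

(* In the coordinate e^a, the vector field attached to (x, f) is affine. *)
Definition affexp x f : lop A := fun l => (if l is [::] then x else 0) + f (sexp l).

(** Solves [lop_nr_sexpE] for its leading term. The recursive calls, on left parts of splittings,
    are not structural, so [n] serves as fuel; any value above the length of [l] gives the same
    result. *)
Fixpoint psi_rec (n : nat) p x f l : A :=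
  if n is n'.+1 then
    affexp x f l - lush l (fun a b =>
      if nilp b then 0 else sexp ((par a (+) p, psi_rec n' p x f a) :: b))
  else 0.

Definition psi p x f : lop A := fun l => psi_rec (size l).+1 p x f l.

Lemma psi_recE n p x f l : (size l < n)%N -> psi_rec n p x f l = psi p x f l.
Proof.
have [m + ->] : exists2 m, (size l < m)%N & psi p x f l = psi_rec m p x f l.
  by exists (size l).+1.
elim: n m l => [|n IHn] [|m] l //; rewrite !ltnS => lm ln /=.
congr (_ - _); apply: ush_congr => a b Hs _ _; case: ifP => // b0.
have ab : (size a < size l)%N by rewrite -Hs -addn1 leq_add2l; case: b b0 {Hs}.
by rewrite (IHn m) // (leq_trans ab).
Qed.

Lemma lop_nr_psi p x f : lop_nr p sexp (psi p x f) = affexp x f.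
Proof.
apply/funext => l; rewrite lop_nr_sexpE {1}/psi /= addrAC -addrA.
rewrite [X in _ + X](_ : _ = 0) ?addr0 //; apply/eqP; rewrite subr_eq0; apply/eqP.
apply: ush_congr => a b Hs _ _; case: ifP => // b0; rewrite psi_recE //.
by rewrite -Hs -addn1 leq_add2l; case: b b0 {Hs}.
Qed.

(** Linearity, the Jacobi identity and the closed forms for Id and 1 all come from here, without
    unfolding the recursion. *)
Lemma psi_unique p x f F : lop_nr p sexp F = affexp x f -> F = psi p x f.
Proof. by move=> E; apply: (@lop_nr_sexp_inj p); rewrite lop_nr_psi. Qed.

Lemma psi0 p x f : psi p x f [::] = x + f gone.
Proof. by rewrite /psi /= subr0 /affexp sexp0. Qed.

Lemma affexp_linear k x y f g :
  affexp (k *: x + y) (fun a => k *: f a + g a) = k *: affexp x f + affexp y g.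
Proof.
apply/funext => l; rewrite -[RHS]/(k *: affexp x f l + affexp y g l) /affexp.
by rewrite scalerDr addrACA; congr (_ + _); case: l => //; rewrite scaler0 addr0.
Qed.

Lemma psi_linear p k x y f g :
  psi p (k *: x + y) (fun a => k *: f a + g a) = k *: psi p x f + psi p y g.
Proof.
by apply/esym/psi_unique; rewrite (lop_nr_linearr p (@mlin_sexp K A)) !lop_nr_psi
  -affexp_linear.
Qed.

Lemma psi00 p : psi p 0 (fun _ => 0) = 0.
Proof.
have := psi_linear p (-1) 0 0 (fun _ => 0) (fun _ => 0).
rewrite scaleN1r oppr0 addr0 scaleN1r addNr => <-; congr psi.
Qed.

(** [f] acts on values, so it commutes with the insertion of [F]. The constant [x] disappears
    because [lop_nr] evaluates its outer operator on nonempty lists only. *)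
Lemma lop_nr_affexp q x f F y g : linear f -> lop_nr q sexp F = affexp y g ->
  lop_nr q (affexp x f) F = affexp (f y) (fun a => f (g a)).
Proof.
move=> lf E; apply/funext => l; rewrite /lop_nr /affexp /=.
under eq_ush => a b do rewrite add0r.
rewrite -lin_ush // -[X in f X]/(lop_nr q sexp F l) E /affexp linD //.
by congr (_ + _); case: l => //; rewrite lin0.
Qed.

(* The associator of lop_nr is symmetric, so that composing with E = sexp turns the
   bracket of the psi's into the bracket of the affine vector fields. *)
Lemma psi_Jacobi p q x y f g : linear f -> linear g ->
  psi (p (+) q) (f y - sg (p && q) (g x)) (fun a => f (g a) - sg (p && q) (g (f a))) =
  lop_nr q (psi p x f) (psi q y g) - sg (p && q) (lop_nr p (psi q y g) (psi p x f)).
Proof.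
move=> lf lg; apply/esym/psi_unique.
have El := @mlin_sexp K A; have Es := @gsym_sexp K A.
have assoc r s F G : lop_nr (r (+) s) sexp (lop_nr s F G) =
    lop_nr s (lop_nr r sexp F) G - lop_assoc r s sexp F G by rewrite lop_nrA // addrK.
rewrite (linB (lop_nr_linearr _ El)) (lin_sg (lop_nr_linearr _ El)) assoc.
rewrite [p (+) q]addbC assoc !lop_nr_psi.
rewrite (lop_nr_affexp x lf (lop_nr_psi _ _ _)) (lop_nr_affexp y lg (lop_nr_psi _ _ _)).
apply/funext => l; set U := psi p x f; set V := psi q y g.
transitivity (affexp (f y) (fun a => f (g a)) l - lop_assoc p q sexp U V l
   - sg (p && q) (affexp (g x) (fun a => g (f a)) l - lop_assoc q p sexp V U l)).
  by congr (_ - _); case: (p && q).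
(* The two associators cancel here. *)
rewrite sgB -(lop_assocC _ _ _ _ _ Es) opprB addrA subrK /affexp.
by rewrite sgD opprD addrACA; congr (_ + _); case: l => //=; rewrite sg0 subr0.
Qed.

Lemma nilp_mid (T : Type) (r1 r2 : seq T) t : nilp (r1 ++ t :: r2) = false.
Proof. by case: r1. Qed.

(** The recursion preserves symmetry: an exchange inside [a] leaves the label of the inserted value
    unchanged, and one inside [b] takes place behind the inserted head of [sexp]. *)
Lemma gsym_psi p x f : linear f -> gsym lab (psi p x f).
Proof.
move=> lf l1 c d l2.
have E n : gsym lab (psi_rec n p x f).
  elim: n => [|n IHn] m1 u v m2; first by rewrite /= sg0.
  rewrite /= sgB; congr (_ - _).
    rewrite /affexp gsym_sexp lin_sg // sgD; congr (_ + _).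
    by case: m1 => [|? ?]; rewrite sg0.
  apply: (ush_gsym (F := fun a b => if nilp b then 0 else _)) => [b|a] r1 s t r2.
    case: ifP => _; rewrite ?sg0 // IHn (mlin_sg [::]); last exact: mlin_sexp.
    by rewrite !parity_cat /= [s.1 (+) (t.1 (+) _)]addbCA.
  by rewrite !nilp_mid; exact: (gsym_sexp (_ :: _)).
rewrite -!(@psi_recE (size (l1 ++ c :: d :: l2)).+1) ?size_cat //; exact: E.
Qed.

Lemma mlin_psi p x f : linear f -> mlin (psi p x f).
Proof.
move=> lf l1 c k u v l2.
have E n : mlin (psi_rec n p x f).
  elim: n => [|n IHn] m1 {}c {}k s t m2; first by rewrite /= scaler0 addr0.
  rewrite /= scalerBr addrACA -opprD; congr (_ - _).
    rewrite /affexp mlin_sexp lf scalerDr addrACA; congr (_ + _).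
    by case: m1 => [|? ?]; rewrite scaler0 addr0.
  apply: (ush_mlin (F := fun a b => if nilp b then 0 else _)) => [b|a] r1 {}c {}k w z r2.
    case: ifP => _; first by rewrite scaler0 addr0.
    by rewrite IHn !parity_cat /= (@mlin_sexp _ _ [::]).
  by rewrite !nilp_mid; exact: (mlin_sexp (_ :: _)).
rewrite -!(@psi_recE (size (l1 ++ (c, u) :: l2)).+1) ?size_cat //; exact: E.
Qed.

Lemma psi_id : psi false 0 id = @conv_one K A.
Proof.
apply/esym/psi_unique/funext => l; rewrite /lop_nr ush_split_first.
rewrite (sexp_cons1 charK) // ush_eq0.
  by rewrite addr0 /affexp; case: l => [|? ?]; rewrite add0r.
case=> [|y a] b _ //=; apply: (mlin0 [::] _ b (@mlin_sexp K A)).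
Qed.

Lemma psi_one : psi false gone (fun _ => 0) = @sexpN K A.
Proof.
apply/esym/psi_unique; rewrite (lop_nr_sexp_sexpN charK).
by apply/funext => l; rewrite /affexp addr0.
Qed.

End Psi.

(** * Koszul signs and shuffles *)

Definition podd (i : int) : bool := odd (absz i).

Lemma poddM i j : odd (absz (i * j)) = podd i && podd j.
Proof. by rewrite abszM oddM. Qed.

Lemma poddD i j : podd (i + j) = podd i (+) podd j.
Proof. rewrite /podd; lia. Qed.

Lemma signr_sg (K : fieldType) (V : lmodType K) n (v : V) :
  (-1) ^+ n *: v = sg (odd n) v.
Proof. by rewrite -signr_odd; case: (odd n); rewrite ?expr1 ?scaleN1r // expr0 scale1r. Qed.

Lemma dsign_sg (K : fieldType) (V : lmodType K) i j (v : V) :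
  dsign K i j *: v = sg (podd i && podd j) v.
Proof. by rewrite /dsign signr_sg poddM. Qed.

Section Inversions.
Variables (N : nat) (lab : 'I_N -> bool).
Implicit Types (r : seq 'I_N).

Definition odd_inv (x y : 'I_N) : bool := (y < x)%N && (lab x && lab y).

Fixpoint ninv r : nat :=
  if r is x :: r' then (count (odd_inv x) r' + ninv r')%N else 0%N.

Let le := relpre val leq : rel 'I_N.

Let le_trans : transitive le.
Proof. by move=> x y z; apply: leq_trans. Qed.

Let le_anti : antisymmetric le.
Proof. by move=> x y /anti_leq/ord_inj. Qed.

Let le_total : total le.
Proof. by move=> x y; apply: leq_total. Qed.

Lemma sorted_insert x r : uniq (x :: r) -> 
  sort le r = [seq y : 'I_N <- sort le r | (y < x)%N] ++ [seq y : 'I_N <- sort le r | (x <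
    y)%N] /\
  sort le (x :: r) =
    [seq y : 'I_N <- sort le r | (y < x)%N] ++ x :: [seq y : 'I_N <- sort le r | (x < y)%N].
Proof.
move=> /= /andP[xr ur]; set s := sort le r.
have ss : sorted le s by apply: sort_sorted.
have xs : x \notin s by rewrite mem_sort.
have gtE : [seq y : 'I_N <- s | (x < y)%N] = [seq y : 'I_N <- s | ~~ (y < x)%N].
  apply: eq_in_filter => y ys; rewrite -leqNgt [RHS]leq_eqVlt.
  by case: eqP => // /ord_inj e; rewrite e ys in xs.
have P1 : perm_eq ([seq y : 'I_N <- s | (y < x)%N] ++ [seq y : 'I_N <- s | (x < y)%N]) s.
  by rewrite gtE; apply: permEl (perm_filterC _ _).
have S : sorted le ([seq y : 'I_N <- s | (y < x)%N] ++ x :: [seq y : 'I_N <- s | (x < y)%N]).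
  rewrite (sorted_pairwise le_trans) pairwise_cat /= -!(sorted_pairwise le_trans).
  rewrite !(sorted_filter le_trans) // !andbT; apply/andP; split.
    apply/allrelP => u w; rewrite mem_filter inE => /andP[ux _] /orP[/eqP->|].
      exact: ltnW.
    by rewrite mem_filter => /andP[xw _]; apply/ltnW/(ltn_trans ux).
  by apply/allP => w; rewrite mem_filter => /andP[/ltnW].
split; apply: (sorted_eq le_trans le_anti) => //.
- move: S; rewrite !(sorted_pairwise le_trans) !pairwise_cat /=.
  by case/and3P => /allrelP H -> /andP[_ ->]; rewrite !andbT; apply/allrelP => u w Hu Hw;
    apply: H; rewrite // inE Hw orbT.
- by rewrite perm_sym.
- exact: sort_sorted.
- apply: (@perm_trans _ (x :: s)); first by rewrite perm_sort perm_cons perm_sym perm_sort.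
  rewrite perm_sym; apply: (perm_trans (permEl (perm_catCA _ [:: x] _))).
  by rewrite /= perm_cons.
Qed.

Lemma parity_count x r :
  lab x && parity lab [seq y : 'I_N <- r | (y < x)%N] = odd (count (odd_inv x) r).
Proof.
elim: r => [|y r IHr] /=; first by rewrite andbF.
rewrite oddD -IHr /odd_inv; case: ifP => //= _.
by case: (lab x) (lab y) => [] [] /=; rewrite ?andbF.
Qed.

(** Insertion sort: the tail is sorted behind an arbitrary prefix [l1], then [x] moves past the
    smaller entries at the cost of the odd inversions that begin with [x]. *)
Lemma gsym_sort (W : zmodType) (F : seq 'I_N -> W) r : gsym lab F -> uniq r ->
  F r = sg (odd (ninv r)) (F (sort le r)).
Proof.
move=> Fs; rewrite -[F r]/(F ([::] ++ r)) -[sort le r]/([::] ++ sort le r).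
elim: r [::] => [|x r IHr] l1 // /[dup] uxr /= /andP[xr ur].
rewrite -cat_rcons IHr // cat_rcons.
have [E ->] := sorted_insert uxr; rewrite {1}E.
rewrite (gsym_move _ _ _ _ Fs) sgK parity_count oddD addbC; congr (sg (odd _ (+) _) _).
by rewrite count_sort.
Qed.

(** Turns the recursive count into a double sum over pairs of places, the form of the cardinal in
    [ksign]. *)
Lemma ninv_map_sorted (s : 'I_N -> 'I_N) r : sorted (relpre val ltn) r ->
  ninv (map s r) =
  (\sum_(i <- r) count (fun j : 'I_N => (i < j) && odd_inv (s i) (s j)) r)%N.
Proof.
elim: r => [|i r IHr] Hs /=; first by rewrite big_nil.
have ltr : transitive (relpre val ltn : rel 'I_N) by move=> x y z; apply: ltn_trans.
have ir : all (fun j : 'I_N => i < j)%N r by have := order_path_min ltr Hs.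
rewrite big_cons /= ltnn /= add0n IHr ?(path_sorted Hs) //; congr (_ + _)%N.
  by rewrite count_map; apply: eq_in_count => j jr /=; rewrite (allP ir _ jr).
apply: eq_big_seq => j jr; rewrite ltnNge ltnW //=; exact: (allP ir _ jr).
Qed.

End Inversions.

Lemma sorted_enum_ord N : sorted (relpre val ltn) (enum 'I_N).
Proof. by rewrite -sorted_map val_enum_ord iota_ltn_sorted. Qed.

Lemma sort_perm_enum N (s : 'S_N) :
  sort (relpre val leq) (map s (enum 'I_N)) = enum 'I_N.
Proof.
apply: (@sorted_eq _ (relpre val leq)).
- by move=> x y z; apply: leq_trans.
- by move=> x y /anti_leq/ord_inj.
- by apply: sort_sorted => x y; apply: leq_total.
- by rewrite -sorted_map val_enum_ord iota_sorted.
rewrite perm_sort; apply: uniq_perm; rewrite ?(map_inj_uniq perm_inj) ?enum_uniq //.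
move=> x; rewrite mem_enum inE; apply/mapP; exists (s^-1%g x); rewrite ?mem_enum //.
by rewrite permKV.
Qed.

Lemma ksign_ninv (K : fieldType) N (s : 'S_N) (d : 'I_N -> int) (V : lmodType K) (w : V) :
  ksign K s d *: w = sg (odd (ninv (podd \o d) (map s (enum 'I_N)))) w.
Proof.
rewrite /ksign signr_sg; congr (sg (odd _) _).
rewrite ninv_map_sorted ?sorted_enum_ord // big_enum /=.
under [RHS]eq_bigr => i _ do rewrite -sum1_count big_enum_cond /=.
rewrite pair_big_dep -sum1_card; apply: eq_bigl => -[i j].
by rewrite inE /= /odd_inv /= poddM.
Qed.

Lemma gsym_ksign (K : fieldType) N (s : 'S_N) (d : 'I_N -> int) (V : lmodType K)
    (F : seq 'I_N -> V) : gsym (podd \o d) F ->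
  F (enum 'I_N) = ksign K s d *: F (map s (enum 'I_N)).
Proof.
move=> Fs; have us : uniq (map s (enum 'I_N)) by rewrite (map_inj_uniq perm_inj) enum_uniq.
by rewrite ksign_ninv (gsym_sort Fs us) sgK addbb sort_perm_enum.
Qed.

(** * Shuffles as subsets *)

Section Shuffles.
Variables (N : nat) (lab : 'I_N -> bool) (W : zmodType).
Implicit Types (r : seq 'I_N) (I : {set 'I_N}).
Let lt := relpre val ltn : rel 'I_N.

(** A minimal [x] is inverted with the odd entries before it, which is the sign that [ush] charges
    when its head goes to the right part. *)
Lemma ninv_min x r1 r2 : all (lt x) r1 -> all (lt x) r2 ->
  odd (ninv lab (r1 ++ x :: r2)) = (lab x && parity lab r1) (+) odd (ninv lab (r1 ++ r2)).
Proof.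
move=> + H2; have c0 r : all (lt x) r -> count (odd_inv lab x) r = 0%N.
  elim: r => //= y r IHr /andP[xy /IHr ->]; rewrite addn0 /odd_inv ltnNge ltnW //.
elim: r1 => [_|y r1 IHr] /=; first by rewrite andbF (c0 _ H2).
case/andP=> xy /IHr; rewrite !oddD => ->; have {}xy : (x < y)%N := xy;
  rewrite !count_cat /= !oddD /odd_inv xy.
by case: (lab x) (lab y) (parity lab r1) (odd (count _ r1)) (odd (count _ r2)) (odd (ninv _
  _)) => [] [] [] [] [] [].
Qed.

(** The sum is indexed by the set [I] of entries sent to the left; whether [I] contains the least
    entry decides between the two branches of [ush]. *)
Lemma ush_sets r (F : seq 'I_N -> seq 'I_N -> W) : sorted lt r ->
  ush lab r F = \sum_(I : {set 'I_N} | I \subset [set y in r])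
    sg (odd (ninv lab ([seq y : 'I_N <- r | y \in I] ++ [seq y : 'I_N <- r | y \notin I])))
      (F [seq y : 'I_N <- r | y \in I] [seq y : 'I_N <- r | y \notin I]).
Proof.
have lttr : transitive lt by move=> x y z; apply: ltn_trans.
elim: r F => [|x r IHr] F Hs.
  rewrite (big_pred1 set0) //= => I; rewrite -[RHS]/(I == set0) -subset0.
  rewrite (_ : [set y in _] = set0) //; by apply/setP => y; rewrite !inE.
have xr : all (lt x) r := order_path_min lttr Hs.
have xNr : x \notin r by apply/negP => /(allP xr); rewrite /lt /= ltnn.
have xf (P : pred 'I_N) : all (lt x) (filter P r).
  by apply/allP => y; rewrite mem_filter => /andP[_ /(allP xr)].
rewrite /= !IHr ?(path_sorted Hs) // [RHS](bigID (fun I => x \in I)) /=; congr (_ + _).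
  rewrite [RHS](reindex_onto (fun I => x |: I) (fun I => I :\ x)); last first.
    by move=> I /andP[_ xI]; rewrite setD1K.
  apply: eq_big => [I|I sI].
    rewrite setU11 andbT; apply/idP/andP => [sI|[sI /eqP xI]].
      split.
        apply/subsetP => y; rewrite !inE; case/predU1P => [->|/(subsetP sI)]; rewrite ?eqxx //.
        by rewrite inE => ->; rewrite orbT.
      apply/eqP/setU1K; apply: contra xNr => /(subsetP sI); by rewrite inE.
    apply/subsetP => y yI; have := subsetP sI y; rewrite !inE yI orbT => /(_ isT).
    by case/predU1P => // e; move: yI; rewrite -xI e !inE eqxx.
  rewrite setU11 /= (_ : [seq y : 'I_N <- r | y \in x |: I] = [seq y : 'I_N <- r | y \in
    I]); last first.
    by apply: eq_in_filter => y yr; rewrite !inE; case: eqP => // e; rewrite -e yr in xNr.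
  rewrite (_ : [seq y : 'I_N <- r | y \notin x |: I] = [seq y : 'I_N <- r | y \notin I]);
    last first.
    by apply: eq_in_filter => y yr; rewrite !inE; case: eqP => // e; rewrite -e yr in xNr.
  congr sg; rewrite -[RHS]/(odd (ninv lab ([::] ++ x :: (_ ++ _)))).
  by rewrite ninv_min ?all_cat ?xf // andbF.
apply: eq_big => [I|I sI].
  apply/idP/andP => [sI|[sI xI]].
    split; last by apply: contra xNr => /(subsetP sI); rewrite inE.
    by apply/subsetP => y /(subsetP sI); rewrite !inE => ->; rewrite orbT.
  apply/subsetP => y yI; have := subsetP sI y yI; rewrite !inE.
  by case/predU1P => // e; rewrite -e yI in xI.
have xI : x \notin I by apply: contra xNr => /(subsetP sI); rewrite inE.
rewrite (negPf xI) /= sgK; congr sg; rewrite ninv_min //.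
by rewrite addbC.
Qed.

End Shuffles.

Lemma size_filter_enum (T : finType) (I : {set T}) :
  size [seq y <- enum T | y \in I] = #|I|.
Proof.
by rewrite size_filter -sum1_count big_enum_cond -sum1_card; apply: eq_bigl.
Qed.

Section ShuffleSum.
Variables (K : fieldType) (V : lmodType K) (m n : nat) (d : 'I_(m + n) -> int).
Variable F : seq 'I_(m + n) -> seq 'I_(m + n) -> V.
Let lt := relpre val ltn : rel 'I_(m + n).

Let lt_trans : transitive lt.
Proof. by move=> x y z; apply: ltn_trans. Qed.

Let lt_irr : irreflexive lt.
Proof. by move=> x; apply: ltnn. Qed.

Let lpart (s : 'S_(m + n)) := [seq s (lshift n i) | i <- enum 'I_m].
Let rpart (s : 'S_(m + n)) := [seq s (rshift m i) | i <- enum 'I_n].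

Lemma enum_lrshift : enum 'I_(m + n) = map (lshift n) (enum 'I_m) ++ map (@rshift m n) (enum
  'I_n).
Proof.
apply: (inj_map val_inj); rewrite val_enum_ord map_cat -(map_comp val (lshift n)) -(map_comp
  val (@rshift m n)) iotaD; congr (_ ++ _).
  by rewrite -val_enum_ord; apply: eq_map.
by rewrite -[LHS]/(iota m n) -[in LHS](addn0 m) iotaDl -val_enum_ord -(map_comp (addn m)
  val); apply: eq_map.
Qed.

Let map_parts (s : 'S_(m + n)) : map s (enum 'I_(m + n)) = lpart s ++ rpart s.
Proof. by rewrite enum_lrshift map_cat -(map_comp s (lshift n)) -(map_comp s (@rshift m n)).
  Qed.

Let lset (s : 'S_(m + n)) : {set 'I_(m + n)} := [set y in lpart s].

Let sorted_parts (s : 'S_(m + n)) : s \in shuffles m n -> sorted lt (lpart s) /\ sorted lt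
  (rpart s).
Proof.
rewrite inE => /forallP /= H; split.
  rewrite /lpart sorted_map; apply: (sub_sorted _ (sorted_enum_ord m)) => i j /= ij.
  have /forallP /(_ (lshift n j)) /implyP := H (lshift n i); apply => /=.
  by rewrite ij ltn_ord.
rewrite /rpart sorted_map; apply: (sub_sorted _ (sorted_enum_ord n)) => i j /= ij.
have /forallP /(_ (rshift m j)) /implyP := H (rshift m i); apply => /=.
by rewrite ltn_add2l ij leq_addr orbT.
Qed.

Let mem_rpart (s : 'S_(m + n)) y : (y \in rpart s) = (y \notin lset s).
Proof.
rewrite inE; have : y \in map s (enum 'I_(m + n)).
  by apply/mapP; exists (s^-1%g y); rewrite ?mem_enum ?permKV.
have: uniq (map s (enum 'I_(m + n))) by rewrite (map_inj_uniq perm_inj) enum_uniq.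
rewrite map_parts cat_uniq mem_cat => /and3P[_ /hasPn D _].
by case: (boolP (y \in rpart s)) => [/D/negPf ->|_] //; rewrite orbF => ->.
Qed.

Let lpartE (s : 'S_(m + n)) : s \in shuffles m n ->
  lpart s = [seq y : 'I_(m + n) <- enum 'I_(m + n) | y \in lset s].
Proof.
move=> Hs; apply: (irr_sorted_eq lt_trans lt_irr); first by case: (sorted_parts Hs).
  by apply: (sorted_filter lt_trans); apply: sorted_enum_ord.
by move=> y; rewrite mem_filter mem_enum andbT inE.
Qed.

Let rpartE (s : 'S_(m + n)) : s \in shuffles m n ->
  rpart s = [seq y : 'I_(m + n) <- enum 'I_(m + n) | y \notin lset s].
Proof.
move=> Hs; apply: (irr_sorted_eq lt_trans lt_irr); first by case: (sorted_parts Hs).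
  by apply: (sorted_filter lt_trans); apply: sorted_enum_ord.
by move=> y; rewrite mem_filter mem_enum andbT mem_rpart.
Qed.

Let lset_inj : {in shuffles m n &, injective lset}.
Proof.
move=> s t Hs Ht e; apply/permP => i.
have: map s (enum 'I_(m + n)) = map t (enum 'I_(m + n)).
  by rewrite !map_parts !lpartE // !rpartE // e.
by move/eq_in_map; apply; rewrite mem_enum.
Qed.

Let card_lset s : #|lset s| = m.
Proof.
rewrite cardsE; have /card_uniqP -> : uniq (lpart s).
  by rewrite map_inj_uniq ?enum_uniq // => i j /perm_inj /lshift_inj.
by rewrite size_map size_enum_ord.
Qed.

Let lset_surj (I : {set 'I_(m + n)}) : #|I| = m -> exists2 s, s \in shuffles m n & I = lset s.
Proof.
move=> cI.
pose A := [seq y : 'I_(m + n) <- enum 'I_(m + n) | y \in I].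
pose B := [seq y : 'I_(m + n) <- enum 'I_(m + n) | y \notin I].
have sA : size A = m.
  by rewrite -[RHS]cI size_filter_enum.
have pAB : perm_eq (A ++ B) (enum 'I_(m + n)) by apply: permEl (perm_filterC _ _).
have sAB : size (A ++ B) = (m + n)%N by rewrite (perm_size pAB) size_enum_ord.
have uAB : uniq (A ++ B) by rewrite (perm_uniq pAB) enum_uniq.
have sB : size B = n by move: sAB; rewrite size_cat sA => /addnI.
(* Places run through the increasing enumeration of [I], then through that of its complement; the
   default [i] is never reached. *)
pose w (i : 'I_(m + n)) := nth i (A ++ B) i.
have winj : injective w.
  move=> i j; rewrite /w (set_nth_default j) ?sAB // => /eqP.
  by rewrite nth_uniq ?sAB // => /eqP/ord_inj.
have wl i : w (lshift n i) = nth (w (lshift n i)) A i.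
  by rewrite {1}/w nth_cat sA /= ltn_ord; apply: set_nth_default; rewrite sA.
have wr j : w (rshift m j) = nth (w (rshift m j)) B j.
  by rewrite {1}/w nth_cat sA /= ltnNge leq_addr /= addKn; apply: set_nth_default; rewrite sB.
have sorted_flt (P : pred 'I_(m + n)) : sorted lt [seq y : 'I_(m + n) <- enum 'I_(m + n) | P y].
  by apply: (sorted_filter lt_trans); apply: sorted_enum_ord.
exists (perm winj).
  rewrite inE; apply/forallP => i; apply/forallP => j; apply/implyP => /andP[ij].
  rewrite !permE => /orP[jm|mi].
    have im := ltn_trans ij jm.
    have -> : i = lshift n (Ordinal im) by apply: val_inj.
    have -> : j = lshift n (Ordinal jm) by apply: val_inj.
    rewrite wl [w (lshift n (Ordinal jm))]wl (set_nth_default (w (lshift n (Ordinal jm))))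
      ?sA //.
    by have := sorted_ltn_nth lt_trans (w (lshift n (Ordinal jm))) (sorted_flt (mem I));
      apply; rewrite ?inE ?sA.
  have mj : (m <= j)%N by rewrite (leq_trans mi) // ltnW.
  have i' : (i - m < n)%N by rewrite ltn_subLR.
  have j' : (j - m < n)%N by rewrite ltn_subLR.
  have -> : i = rshift m (Ordinal i') by apply: val_inj; rewrite /= subnKC.
  have -> : j = rshift m (Ordinal j') by apply: val_inj; rewrite /= subnKC.
  rewrite wr [w (rshift m (Ordinal j'))]wr (set_nth_default (w (rshift m (Ordinal j')))) ?sB //.
  have := sorted_ltn_nth lt_trans (w (rshift m (Ordinal j'))) (sorted_flt (fun y => y \notin
    I)); apply; rewrite ?inE ?sB //=.
  by rewrite ltn_sub2r // (leq_ltn_trans mi).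
apply/eqP; rewrite eq_sym eqEcard card_lset cI leqnn andbT.
apply/subsetP => y; rewrite inE => /mapP[i _ ->]; rewrite permE wl.
by have := mem_nth (w (lshift n i)) (_ : i < size A)%N;
  rewrite mem_filter sA => /(_ (ltn_ord i)) /andP[].
Qed.

(** A shuffle is determined by the set of its first [m] values, and every set of [m] elements
    occurs; [ush_sets] is indexed by the same sets. *)
Lemma shuffles_ush :
  \sum_(s in shuffles m n) ksign K s d *: F (lpart s) (rpart s) =
  ush (podd \o d) (enum 'I_(m + n)) (fun a b => if size a == m then F a b else 0).
Proof.
rewrite ush_sets ?sorted_enum_ord //.
rewrite [RHS](eq_bigl predT); last first.
  by move=> I; apply/subsetP => y _; rewrite inE mem_enum.
rewrite [RHS](bigID (fun I : {set 'I_(m + n)} => #|I| == m)) /= [X in _ = _ + X]big1 ?addr0;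
  last first.
  by move=> I; rewrite -size_filter_enum => /negPf ->; rewrite sg0.
transitivity (\sum_(I in [set lset s | s in shuffles m n])
    sg (odd (ninv (podd \o d) ([seq y : 'I_(m + n) <- enum 'I_(m + n) | y \in I] ++ [seq y :
      'I_(m + n) <- enum 'I_(m + n) | y \notin I])))
      (F [seq y : 'I_(m + n) <- enum 'I_(m + n) | y \in I] [seq y : 'I_(m + n) <- enum 'I_(m
        + n) | y \notin I])).
  pose h := lset; have hi : {in shuffles m n &, injective h} by move=> s t Hs Ht;
    apply: lset_inj.
  rewrite -[LHS]/(\sum_(s in shuffles m n) _) (@big_imset _ _ _ _ _ h _ _ hi);
    apply: eq_bigr => s Hs.
  by rewrite /h ksign_ninv map_parts lpartE // rpartE.
apply: eq_big => [I|I /imsetP[s Hs ->]].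
  apply/imsetP/eqP => [[s _ ->]|/lset_surj[s Hs ->]]; first exact: card_lset.
  by exists s.
by rewrite -lpartE // size_map size_enum_ord eqxx.
Qed.

End ShuffleSum.

(** * Operators of all arities evaluated on lists *)

Section ListForm.
Variables (K : fieldType) (V : gradedLmodType K).
Implicit Types (F G : forall n, symop n V).

(** Reading the arity off the length of the list removes the casts between ['I_(m + (N - m))] and
    ['I_N] from later arguments. *)
Definition on_list F (l : seq V) : V := F (size l) [ffun i => tnth (in_tuple l) i].

Lemma on_listE F n (v : {ffun 'I_n -> V}) l : l = [seq v i | i <- enum 'I_n] ->
  F n v = on_list F l.
Proof.
move=> lE; have e : size l = n by rewrite lE size_map size_enum_ord.
case: n / e v lE => v lE; congr (F _ _); apply/ffunP => i; rewrite ffunE (tnth_nth (v i)) /=.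
transitivity (nth (v i) [seq v j | j <- enum 'I_(size l)] i); last by rewrite -lE.
by rewrite (nth_map i) ?size_enum_ord // nth_ord_enum.
Qed.

Lemma on_list0 F (v : {ffun 'I_0 -> V}) : on_list F [::] = F 0%N v.
Proof. by apply/esym/on_listE; rewrite enum_ord0. Qed.

Lemma map_fcons n x (v : {ffun 'I_n -> V}) :
  [seq fcons x v i | i <- enum 'I_n.+1] = x :: [seq v i | i <- enum 'I_n].
Proof.
rewrite enum_ordSl /= ffunE unlift_none; congr (_ :: _).
rewrite -(map_comp _ (lift ord0)); apply: eq_map => i /=.
by rewrite ffunE liftK.
Qed.

Lemma nr_prodE F G m n d (v : {ffun 'I_(m + n) -> V}) :
  nr_prod (F n.+1) (G m) d v =
  ush (podd \o d) (enum 'I_(m + n)) (fun a b =>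
    if size a == m then on_list F (on_list G (map v a) :: map v b) else 0).
Proof.
rewrite -(@shuffles_ush _ _ m n d (fun a b => on_list F (on_list G (map v a) :: map v b))).
apply: eq_bigr => s _; congr (_ *: _); apply: on_listE.
rewrite map_fcons; congr (_ :: _).
  by apply/esym/on_listE; rewrite -(map_comp v); apply: eq_map => i; rewrite ffunE.
by rewrite -(map_comp v); apply: eq_map => i; rewrite ffunE.
Qed.

(** The sum over the arities [m] collapses, since a splitting contributes only at [m = size a]. *)
Lemma nr_mulE F G N (d : 'I_N -> int) (v : {ffun 'I_N -> V}) :
  nr_mul F G d v =
  ush (podd \o d) (enum 'I_N) (fun a b => on_list F (on_list G (map v a) :: map v b)).
Proof.
have cast m n (e : (m + n)%N = N) :
    nr_prod (F n.+1) (G m) (fun i => d (cast_ord e i)) [ffun i => v (cast_ord e i)] =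
    ush (podd \o d) (enum 'I_N) (fun a b =>
      if size a == m then on_list F (on_list G (map v a) :: map v b) else 0).
  case: N / e d v => d v.
  have -> : [ffun i => v (cast_ord (erefl (m + n)%N) i)] = v.
    by apply/ffunP => i; rewrite ffunE cast_ord_id.
  have -> : (fun i => d (cast_ord (erefl (m + n)%N) i)) = d.
    by apply/funext => i; rewrite cast_ord_id.
  exact: nr_prodE.
rewrite /nr_mul; under eq_bigr => m _ do rewrite cast.
rewrite -ush_sum; apply: ush_congr => a b Hs _ _.
have aN : (size a < N.+1)%N by rewrite size_enum_ord in Hs;
  rewrite ltnS (leq_trans (leq_addr _ _) (eq_leq Hs)).
rewrite (bigD1 (Ordinal aN)) //= eqxx big1 ?addr0 // => i.
by move=> ne; case: eqP => // e; case/eqP: ne; apply: val_inj; rewrite /= e.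
Qed.

End ListForm.

(** * Parity and degree *)

Section Homogeneous.
Variables (K : fieldType) (V : gradedLmodType K).
Implicit Types (v w : V) (i j k : int).

Lemma homog0 i : 0 \in @homog K V i.
Proof. by apply/eqP; rewrite linear0. Qed.

Lemma homogD i v w : v \in homog i -> w \in homog i -> v + w \in homog i.
Proof. by move=> /eqP hv /eqP hw; apply/eqP; rewrite linearD /= hv hw. Qed.

Lemma homogN i v : v \in homog i -> - v \in homog i.
Proof. by move=> /eqP hv; apply/eqP; rewrite linearN /= hv. Qed.

Lemma homogB i v w : v \in homog i -> w \in homog i -> v - w \in homog i.
Proof. by move=> hv hw; apply: homogD hv (homogN hw). Qed.

Lemma homog_sg i b v : v \in homog i -> sg b v \in homog i.
Proof. by case: b => // /homogN. Qed.

Lemma homog_gproj i v : gproj i v \in homog i.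
Proof. by apply/eqP; rewrite gprojK eqxx. Qed.

Lemma gproj_homog i j v : v \in homog j -> gproj i v = if i == j then v else 0.
Proof. by move=> /eqP <-; rewrite gprojK. Qed.

Lemma gproj_notin (s : seq int) v j :
  v = \sum_(i <- s) gproj i v -> j \notin s -> gproj j v = 0.
Proof.
move=> -> js; rewrite linear_sum big_seq big1 // => i is_ /=.
by rewrite gprojK; case: eqP => // e; rewrite e is_ in js.
Qed.

Lemma homog_ind (P : V -> Prop) : P 0 -> (forall v w, P v -> P w -> P (v + w)) ->
  (forall i v, v \in homog i -> P v) -> forall v, P v.
Proof.
move=> P0 PD Ph v; have [s [_ ->]] := gproj_sum v.
by elim/big_ind: _ => // i _; apply: Ph (homog_gproj i v).
Qed.

Definition gsupp v : seq int := projT1 (cid (gproj_sum v)).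

Lemma gsupp_uniq v : uniq (gsupp v).
Proof. by have [] := projT2 (cid (gproj_sum v)). Qed.

Lemma gsupp_sum v : v = \sum_(i <- gsupp v) gproj i v.
Proof. by have [] := projT2 (cid (gproj_sum v)). Qed.

(* The even (b = false) or odd (b = true) part of v. *)
Definition gpar (b : bool) v : V := \sum_(i <- gsupp v | podd i == b) gproj i v.

(** [gpar] is defined on a chosen support; any finite set of degrees carrying all components gives
    the same sum. Two vectors can thus share a support, which linearity requires. *)
Lemma gparE b v (s : seq int) : uniq s -> (forall j, j \notin s -> gproj j v = 0) ->
  gpar b v = \sum_(i <- s | podd i == b) gproj i v.
Proof.
have nz r : \sum_(i <- r | podd i == b) gproj i v =
    \sum_(i <- [seq i <- r | gproj i v != 0] | podd i == b) gproj i v.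
  rewrite big_filter_cond (bigID (fun i => gproj i v == 0)) /= big1 ?add0r.
    by apply: eq_bigl => i; rewrite andbC.
  by move=> i /andP[_ /eqP].
move=> us s0; rewrite /gpar nz [RHS]nz; apply: perm_big; apply: uniq_perm.
- by rewrite filter_uniq ?gsupp_uniq.
- by rewrite filter_uniq.
move=> i; rewrite !mem_filter; case: eqP => //= /eqP ni.
apply/idP/idP => _; apply: contraNT ni => /= Hi; apply/eqP; first exact: s0.
exact: gproj_notin (gsupp_sum v) Hi.
Qed.

Lemma gpar_linear b : linear (gpar b).
Proof.
move=> k u v; pose s := undup (gsupp u ++ gsupp v).
have su j : j \notin s -> gproj j u = 0.
  by rewrite mem_undup mem_cat negb_or => /andP[+ _]; apply: gproj_notin (gsupp_sum u).
have sv j : j \notin s -> gproj j v = 0.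
  by rewrite mem_undup mem_cat negb_or => /andP[_]; apply: gproj_notin (gsupp_sum v).
rewrite !(@gparE b _ s) ?undup_uniq //; last first.
  by move=> j Hj; rewrite linearP /= su // sv // scaler0 addr0.
by rewrite scaler_sumr -big_split; apply: eq_bigr => i _; rewrite /= linearP.
Qed.

Lemma gpar_homog b i v : v \in homog i -> gpar b v = if podd i == b then v else 0.
Proof.
move=> hv; rewrite (@gparE b _ [:: i]) //.
  by rewrite big_mkcond big_seq1 (gproj_homog _ hv) eqxx.
by move=> j; rewrite inE (gproj_homog _ hv) => /negPf ->.
Qed.

Lemma gparD v : gpar false v + gpar true v = v.
Proof.
elim/homog_ind: v => [|v w IHv IHw|i v hv].
- by rewrite !(lin0 (gpar_linear _)) addr0.
- by rewrite !(linD (gpar_linear _)) addrACA IHv IHw.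
- by rewrite !(gpar_homog _ hv); case: podd; rewrite ?add0r ?addr0.
Qed.

(** The part of [f] that changes parity by [e], built from [gpar] alone and thus without decomposing
    [f] into homogeneous maps. *)
Definition epar (e : bool) (f : V -> V) : V -> V :=
  fun v => \sum_(c : bool) gpar (e (+) c) (f (gpar c v)).

Lemma eparE e (f : V -> V) v :
  epar e f v = gpar (e (+) true) (f (gpar true v)) + gpar (e (+) false) (f (gpar false v)).
Proof. by rewrite /epar big_bool. Qed.

Lemma epar_linear e (f : V -> V) : linear f -> linear (epar e f).
Proof.
move=> lf k u v; rewrite !eparE !gpar_linear !lf !gpar_linear.
by rewrite scalerDr addrACA.
Qed.

Lemma eparP e (k : K) (f g : V -> V) :
  epar e (fun v => k *: f v + g v) = (fun v => k *: epar e f v + epar e g v).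
Proof.
by apply/funext => v; rewrite !eparE !gpar_linear scalerDr addrACA.
Qed.

Lemma epar_deg e k (f : V -> V) : end_deg k f -> epar e f = fun v => if podd k == e then f v
  else 0.
Proof.
move=> [lf hf]; apply/funext; elim/homog_ind => [|v w IHv IHw|i v hv].
- by rewrite (lin0 (epar_linear e lf)) (lin0 lf) if_same.
- rewrite (linD (epar_linear e lf)) IHv IHw (linD lf).
  by case: ifP; rewrite ?addr0.
rewrite eparE !(gpar_homog _ hv).
by case E: (podd i) => /=; rewrite ?(lin0 lf) ?(lin0 (gpar_linear _)) ?add0r ?addr0
  (gpar_homog _ (hf _ _ hv)) poddD E; case: e (podd k) => [] [].
Qed.

Lemma homog_eq (W : lmodType K) (f g : V -> W) : linear f -> linear g ->
  (forall i v, v \in homog i -> f v = g v) -> f =1 g.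
Proof.
move=> lf lg fg v; elim/homog_ind: v => [|v w IHv IHw|i v]; last exact: fg.
  by rewrite (lin0 lf) (lin0 lg).
by rewrite (linD lf) (linD lg) IHv IHw.
Qed.

End Homogeneous.

Lemma gpar_morph (K : fieldType) (V W : gradedLmodType K) (alpha : V -> W) b v :
  linear alpha -> (forall i x, x \in homog i -> alpha x \in homog i) ->
  alpha (gpar b v) = gpar b (alpha v).
Proof.
move=> la ha; move: v; apply: homog_eq => [k u v|k u v|i v hv].
- by rewrite gpar_linear la.
- by rewrite la gpar_linear.
- by rewrite (gpar_homog _ hv) (gpar_homog _ (ha _ _ hv)); case: ifP; rewrite ?(lin0 la).
Qed.

(** * From labelled lists to operators on vectors *)

Section Multilinear.
Variables (K : fieldType) (V : gradedLmodType K) (n : nat).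
Implicit Types (v : {ffun 'I_n -> V}).

Lemma map_updE (T : Type) (h : 'I_n -> V -> T) v i : exists l1 l2, forall z,
  [seq h j (upd v i z j) | j <- enum 'I_n] = l1 ++ h i z :: l2.
Proof.
have iE : i \in enum 'I_n by rewrite mem_enum.
have := enum_uniq 'I_n; case/splitPr: iE => r1 r2; rewrite cat_uniq /= => /and3P[_].
rewrite negb_or => /andP[ir1 _] /andP[ir2 _].
exists [seq h j (v j) | j <- r1], [seq h j (v j) | j <- r2] => z.
rewrite map_cat /= ffunE eqxx; congr (_ ++ _ :: _); apply/eq_in_map => j jr; rewrite ffunE.
  by case: eqP => // e; rewrite -e jr in ir1.
by case: eqP => // e; rewrite -e jr in ir2.
Qed.

Lemma upd_same v i : upd v i (v i) = v.
Proof. by apply/ffunP => j; rewrite ffunE; case: eqP => [->|]. Qed.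

(** Arguments of a [lop] carry parities, so each vector is replaced by its even and odd parts and
    all choices are added; on homogeneous arguments a single choice survives. *)
Definition op_of_lop (F : lop V) v : V :=
  \sum_(b : {ffun 'I_n -> bool}) F [seq (b i, gpar (b i) (v i)) | i <- enum 'I_n].

Lemma op_of_lop_multilinear F : mlin F -> multilinear (op_of_lop F).
Proof.
move=> Fl v i a x y; rewrite /op_of_lop scaler_sumr -big_split; apply: eq_bigr => b _ /=.
have [l1 [l2 E]] := map_updE (fun j z => (b j, gpar (b j) z)) v i.
by rewrite !E gpar_linear Fl.
Qed.

Lemma op_of_lop_homog F d v : mlin F -> has_degs d v ->
  op_of_lop F v = F [seq (podd (d i), v i) | i <- enum 'I_n].
Proof.
move=> Fl hv; rewrite /op_of_lop (bigD1 [ffun i => podd (d i)]) //= big1 ?addr0 => [|b].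
  by congr F; apply: eq_map => i; rewrite ffunE (gpar_homog _ (hv i)) eqxx.
move=> nb; have [i ni] : exists i, podd (d i) != b i.
  apply/existsP; apply: contra_neqT nb; rewrite negb_exists => /forallP Hb.
  by apply/ffunP => i; rewrite ffunE; have := Hb i; rewrite negbK => /eqP.
have [l1 [l2 E]] := map_updE (fun j z => (b j, gpar (b j) z)) v i.
by rewrite -(upd_same v i) E (gpar_homog _ (hv i)) (negPf ni) mlin0.
Qed.

Lemma op_of_lop_gsym F : mlin F -> gsym fst F -> graded_symmetric (op_of_lop F).
Proof.
move=> Fl Fs d v s hv.
have hvs : has_degs (d \o s) [ffun i => v (s i)] by move=> i; rewrite ffunE; apply: hv.
rewrite (op_of_lop_homog Fl hv) (op_of_lop_homog Fl hvs).
rewrite (@gsym_ksign K n s d V (fun r => F [seq (podd (d i), v i) | i <- r])).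
  by rewrite -map_comp; congr (_ *: F _); apply: eq_map => i; rewrite /= ffunE.
by move=> l1 x y l2; rewrite !map_cat Fs.
Qed.

Lemma multilinear_eq (f g : {ffun 'I_n -> V} -> V) : multilinear f -> multilinear g ->
  (forall d v, has_degs d v -> f v = g v) -> f =1 g.
Proof.
move=> lf lg fg.
(* [r] lists the places whose argument is still arbitrary; they are made homogeneous one at a
   time. *)
suff E (r : seq 'I_n) v : (forall i, i \notin r -> exists k, v i \in homog k) -> f v = g v.
  by move=> v; apply: (E (enum 'I_n)) => i; rewrite mem_enum.
elim: r v => [|i r IHr] v Hv.
  have /choice[d Hd] : forall i, exists k, v i \in homog k by move=> i; apply: Hv.
  exact: fg Hd.
rewrite -(upd_same v i); move: (v i); apply: homog_eq => [k x y|k x y|k x hx].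
- exact: lf.
- exact: lg.
apply: IHr => j jr; rewrite ffunE; case: eqP => [_|/eqP ji]; first by exists k.
by apply: Hv; rewrite inE negb_or ji.
Qed.

End Multilinear.

Section DegreeLabels.
Variables (K : fieldType) (V : gradedLmodType K).
Implicit Types (l a b : seq (int * V)) (F : lop V).

Definition plab (x : int * V) : bool * V := (podd x.1, x.2).
Definition homogl : pred (int * V) := fun x => x.2 \in homog x.1.
Definition degl l : int := \sum_(x <- l) x.1.

Lemma degl_cons x l : degl (x :: l) = x.1 + degl l.
Proof. by rewrite /degl big_cons. Qed.

Lemma parity_plab l : parity fst (map plab l) = podd (degl l).
Proof.
elim: l => [|x l IHl]; first by rewrite /degl big_nil.
by rewrite degl_cons poddD -IHl.
Qed.

Lemma ush_plab (W : zmodType) l (F : seq (bool * V) -> seq (bool * V) -> W) :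
  ush fst (map plab l) F = ush (podd \o fst) l (fun a b => F (map plab a) (map plab b)).
Proof. exact: ush_map. Qed.

Definition ldeg (k : int) F : Prop := forall l, all homogl l ->
  F (map plab l) \in homog (degl l + k).

Lemma homog_ush_degl (T : seq (int * V) -> seq (int * V) -> V) l k : all homogl l ->
  (forall a b, all homogl a -> all homogl b -> degl a + degl b = degl l ->
     T a b \in homog k) ->
  ush (podd \o fst) l T \in homog k.
Proof.
elim: l T => [|x l IHl] T /=; first by move=> _; apply; rewrite // /degl big_nil addr0.
case/andP=> hx hl H; apply: homogD; apply: IHl => // a b ha hb E; last apply: homog_sg.
  by apply: H; rewrite //= ?hx // !degl_cons -E addrA.
by apply: H; rewrite //= ?hx // !degl_cons -E addrCA.
Qed.

End DegreeLabels.

(** * Degree, linearity over the centre and naturality of the solution *)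

Section DegreeAlgebra.
Variables (K : fieldType) (A : gradedAlgType K).
Implicit Types (F G : lop A) (l : seq (int * A)).

Lemma ldeg_conv_one : ldeg 0 (@conv_one K A).
Proof. by case=> [|x l] _; rewrite ?homog0 // /degl big_nil addr0 gone_deg. Qed.

Lemma ldeg_conv_mul F G : ldeg 0 F -> ldeg 0 G -> ldeg 0 (F * G).
Proof.
move=> hF hG l hl; rewrite lopE ush_plab; apply: homog_ush_degl => // a b ha hb <-.
by rewrite addr0 gmul_deg // -[degl _]addr0; [apply: hF | apply: hG].
Qed.

Lemma ldeg_iotaX n : ldeg 0 (@iota1 K A ^+ n).
Proof.
elim: n => [|n IHn]; first exact: ldeg_conv_one.
rewrite exprS; apply: ldeg_conv_mul => // -[|x [|y l]] hl; rewrite ?homog0 //.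
by rewrite degl_cons /degl big_nil !addr0; case/andP: hl.
Qed.

Lemma ldeg_sexp : ldeg 0 (@sexp K A).
Proof. by move=> l hl; rewrite /sexp homogZ // ldeg_iotaX. Qed.

Lemma ldeg_psi p (x : A) (f : A -> A) : x \in homog p -> end_deg p f ->
  ldeg p (psi (podd p) x f).
Proof.
move=> hx [lf hf] l hl; rewrite /psi; move: (size _).+1 => n.
elim: n l hl => [|n IHn] l hl /=; first exact: homog0.
apply: homogB.
  rewrite /affexp; apply: homogD.
    by case: l hl => [|? ?] _; rewrite ?homog0 // /degl big_nil add0r.
  by apply: hf; rewrite -[degl l]addr0 ldeg_sexp.
rewrite ush_plab; apply: homog_ush_degl => // a b ha hb E.
case: ifP => _; first exact: homog0.
rewrite parity_plab -poddD.
have := @ldeg_sexp ((degl a + p, psi_rec n (podd p) x f (map (@plab K A) a)) :: b).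
rewrite /= degl_cons /= addr0 addrAC E; apply.
by rewrite hb andbT; apply: IHn.
Qed.

Section BaseChange.
Variables (k : int) (c : A).
Hypothesis cC : forall i a, a \in homog i -> gmul a c = dsign K i k *: gmul c a.

Definition clinear F : Prop := forall l j (v : A), all (@homogl K A) l -> v \in homog j ->
  F (rcons (map (@plab K A) l) (podd (j + k), gmul v c)) =
  gmul (F (rcons (map (@plab K A) l) (podd j, v))) c.

Lemma clinear_conv_one : clinear (@conv_one K A).
Proof. by case=> [|x l] j v _ _; rewrite /= gmul0l. Qed.

Lemma clinear_iota1 : clinear (@iota1 K A).
Proof. by case=> [|x [|y l]] j v _ _ //=; rewrite gmul0l. Qed.

(** If the last argument goes to [G], then [c] already stands on the right. If it goes to [F], then
    [c] must cross [G b], and that sign cancels the extra one charged because the last argument now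
    has degree [j + k]. *)
Lemma clinear_conv_mul F G : ldeg 0 G -> clinear F -> clinear G -> clinear (F * G).
Proof.
move=> dG cF cG l j v hl hv; rewrite !lopE !ush_rcons gmulDl !gmul_ushl !ush_plab.
congr (_ + _); apply: ush_congr => a b _ _ /(_ (@homogl K A));
  rewrite hl => /(_ isT)/andP[ha hb].
  by rewrite cG // gmulA.
rewrite cF // gmul_sgl -!gmulA (cC (dG _ hb)) addr0 dsign_sg gmul_sgr sgK parity_plab poddD.
congr sg; by case: (podd j) (podd k) (podd (degl b)) => [] [] [].
Qed.

Lemma clinear_iotaX n : clinear (@iota1 K A ^+ n).
Proof.
elim: n => [|n IHn]; first exact: clinear_conv_one.
by rewrite exprS; apply: clinear_conv_mul => //; [apply: ldeg_iotaX | apply: clinear_iota1].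
Qed.

Lemma clinear_sexpN : clinear (@sexpN K A).
Proof.
move=> l j v hl hv; rewrite /sexpN /sexp !size_rcons clinear_iotaX //.
by rewrite !gmulZl.
Qed.
End BaseChange.
End DegreeAlgebra.

Section Naturality.
Variables (K : fieldType) (A B : gradedAlgType K) (alpha : A -> B).
Hypothesis Ha : galg_morphism alpha.
Let amap := map (fun x : bool * A => (x.1, alpha x.2)).

Let la : linear alpha. Proof. by case: Ha. Qed.

Lemma iotaX_nat n l : alpha ((@iota1 K A ^+ n) l) = (@iota1 K B ^+ n) (amap l).
Proof.
case: Ha => _ a1 aM _; elim: n l => [|n IHn] l.
  by rewrite !expr0; case: l => [|x l] //=; rewrite (lin0 la).
rewrite !exprS !lopE (lin_ush la) (ush_map (labU := fst)) //.
apply: eq_ush => a b; rewrite aM IHn; congr (gmul _ _).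
by case: a => [|x [|y a]] //=; rewrite (lin0 la).
Qed.

Lemma sexp_nat l : alpha (sexp l) = sexp (amap l).
Proof. by rewrite /sexp (linZ la) iotaX_nat size_map. Qed.

Lemma psi_nat p x (f : A -> A) (g : B -> B) l : (forall a, g (alpha a) = alpha (f a)) ->
  alpha (psi p x f l) = psi p (alpha x) g (amap l).
Proof.
move=> fg; rewrite /psi size_map; move: (size l).+1 => n.
elim: n l => [|n IHn] l /=; first by rewrite (lin0 la).
rewrite (linB la) /affexp (linD la) -sexp_nat fg; congr (_ + _ - _).
  by case: l => [|? ?] //; rewrite (lin0 la).
rewrite (lin_ush la) (ush_map (labU := fst)) //; apply: eq_ush => a b.
rewrite /nilp size_map; case: ifP => _; first by rewrite (lin0 la).
by rewrite sexp_nat /= IHn (parity_map (labU := fst)).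
Qed.
End Naturality.

(** * The higher Koszul brackets *)

Section PsiOperator.
Variables (K : fieldType) (A : gradedAlgType K).
Implicit Types (x y : A) (n : nat).

Definition psi_op n x (f : A -> A) (v : {ffun 'I_n -> A}) : A :=
  \sum_(e : bool) op_of_lop (psi e (gpar e x) (epar e f)) v.

Lemma op_of_lopP n k (F G : lop A) (v : {ffun 'I_n -> A}) :
  op_of_lop (k *: F + G) v = k *: op_of_lop F v + op_of_lop G v.
Proof. by rewrite /op_of_lop scaler_sumr -big_split. Qed.

Lemma psi_op_linear n k x y (f g : A -> A) (v : {ffun 'I_n -> A}) :
  psi_op (k *: x + y) (fun a => k *: f a + g a) v = k *: psi_op x f v + psi_op y g v.
Proof.
rewrite /psi_op scaler_sumr -big_split; apply: eq_bigr => e _ /=.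
by rewrite -op_of_lopP -psi_linear gpar_linear eparP.
Qed.

Lemma psi_op_homog n p x (f : A -> A) : x \in homog p -> end_deg p f ->
  @psi_op n x f = op_of_lop (psi (podd p) x f).
Proof.
move=> hx hf; apply/funext => v; rewrite /psi_op (bigD1 (podd p)) //= big1 => [|e ne].
  rewrite addr0 (gpar_homog _ hx) eqxx (epar_deg _ hf); congr (op_of_lop (psi _ _ _) v).
  by apply/funext => a; rewrite eqxx.
rewrite (gpar_homog _ hx) (epar_deg _ hf) eq_sym (negPf ne) psi00.
by rewrite /op_of_lop big1.
Qed.

Lemma psi_op_deg n p x (f : A -> A) : x \in homog p -> end_deg p f ->
  op_deg p (@psi_op n x f).
Proof.
move=> hx hf; have [lf _] := hf; rewrite (psi_op_homog _ hx hf).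
have Fl : mlin (psi (podd p) x f) by apply: mlin_psi.
split=> [||d v hv]; first exact: op_of_lop_multilinear.
  by apply: op_of_lop_gsym => //; apply: gsym_psi.
rewrite (op_of_lop_homog Fl hv).
have := ldeg_psi hx hf (l := [seq (d i, v i) | i <- enum 'I_n]).
rewrite -map_comp /degl big_map big_enum; apply.
by apply/allP => _ /mapP[i _ ->]; apply: hv.
Qed.

Lemma end_deg0 p : end_deg p (fun _ : A => 0 : A).
Proof. by split=> [k u v|i v _]; rewrite ?scaler0 ?addr0 ?homog0. Qed.

Lemma psi_op_symop n x (f : A -> A) : f \in @gend_pred K A ->
  @psi_op n x f \in @symop_pred K n A.
Proof.
move=> /asboolP Hf; apply/asboolP.
have E y z (g h : A -> A) : @psi_op n (y + z) (fun a => g a + h a) = psi_op y g + psi_op z h.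
  apply/funext => v; rewrite -[RHS]/(psi_op y g v + psi_op z h v).
  have := psi_op_linear 1 y z g h v; rewrite !scale1r => <-.
  by congr psi_op; apply/funext => a; rewrite scale1r.
(* [x] and [f] are separated because each has its own decomposition into homogeneous parts. *)
have -> : @psi_op n x f = psi_op x (fun _ => 0) + psi_op 0 f.
  by rewrite -E addr0; congr psi_op; apply/funext => a; rewrite add0r.
apply: deg_sumD.
  elim/homog_ind: x => [|y z IHy IHz|i y hy].
  - by apply: (deg_sum_base (k := 0)); apply: psi_op_deg; [apply: homog0 | apply: end_deg0].
  - rewrite (_ : psi_op _ _ = psi_op y (fun _ => 0) + psi_op z (fun _ => 0)).
      exact: deg_sumD.
    by rewrite -E; congr psi_op; apply/funext => a; rewrite addr0.
  - by apply: (deg_sum_base (k := i)); apply: psi_op_deg => //; apply: end_deg0.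
elim/deg_sum_ind: Hf => [|k g h hg IHh].
  by apply: (deg_sum_base (k := 0)); apply: psi_op_deg; [apply: homog0 | apply: end_deg0].
rewrite (_ : psi_op _ _ = psi_op 0 g + psi_op 0 h); last by rewrite -E addr0.
apply: deg_sumD => //; apply: (deg_sum_base (k := k)); apply: psi_op_deg => //.
exact: homog0.
Qed.

Definition Psi_symop n (u : aff A) : symop n A := SymOp (psi_op_symop n u.1 (valP u.2)).

Lemma Psi_symop_linear n : linear (@Psi_symop n).
Proof. by move=> k u w; apply: val_inj; apply/funext => v; exact: psi_op_linear. Qed.

End PsiOperator.

Definition Psi (K : fieldType) : psi_family K := fun A n =>
  HB.pack (@Psi_symop K A n)
    (GRing.isLinear.Build K (aff A) (symop n A) *:%R _ (@Psi_symop_linear K A n)).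

(** * The conditions for the constructed family *)

Section PsiConditions.
Variables (K : fieldType) (charK : [pchar K] =i pred0).

Lemma PsiE (A : gradedAlgType K) n (u : aff A) (v : {ffun 'I_n -> A}) :
  Psi A n u v = psi_op u.1 u.2 v.
Proof. by []. Qed.

Lemma Psi_degE (A : gradedAlgType K) n p (u : aff A) d (v : {ffun 'I_n -> A}) :
  aff_deg p u -> has_degs d v ->
  Psi A n u v = psi (podd p) u.1 u.2 [seq (podd (d i), v i) | i <- enum 'I_n].
Proof.
move=> [hu1 hu2] hv; rewrite PsiE (psi_op_homog _ hu1 hu2) (op_of_lop_homog _ hv) //.
by apply: mlin_psi; apply: gend_linear.
Qed.

Lemma Psi_on_list (A : gradedAlgType K) p (u : aff A) (l : seq (int * A)) :
  aff_deg p u -> all (@homogl K A) l ->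
  on_list (fun n => Psi A n u) (map snd l) = psi (podd p) u.1 u.2 (map (@plab K A) l).
Proof.
have lE : l = [seq tnth (in_tuple l) i | i <- enum 'I_(size l)] by rewrite map_tnth_enum.
move=> hu hl; pose v := [ffun i => (tnth (in_tuple l) i).2].
rewrite -(@on_listE _ _ (fun n => Psi A n u) _ v); last first.
  rewrite {1}lE -map_comp.
  by apply: eq_map => i; rewrite ffunE.
rewrite (@Psi_degE _ _ p _ (fun i => (tnth (in_tuple l) i).1)) //.
  rewrite [in RHS]lE -(map_comp (@plab K A)).
  by congr psi; apply: eq_map => i; rewrite ffunE.
by move=> i; rewrite ffunE; apply: (allP hl); apply: mem_tnth.
Qed.

Lemma aff_deg_bracket (A : gradedAlgType K) p q (u w : aff A) :
  aff_deg p u -> aff_deg q w -> aff_deg (p + q) (aff_bracket p q u w).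
Proof.
move=> [hx [lf hf]] [hy [lg hg]]; split.
  apply: homogB; first by rewrite addrC; apply: hf.
  by apply: homogZ; apply: hg.
split; first exact: gend_linear.
move=> i v hv; apply: homogB; first by rewrite addrA addrAC; apply/hf/hg.
by apply: homogZ; rewrite addrA; apply/hg/hf.
Qed.

Lemma Psi_degree : degree_preserving (@Psi K).
Proof. by move=> A p u [hx hf] n; apply: psi_op_deg. Qed.

Lemma Psi_Jacobi : generalized_Jacobi (@Psi K).
Proof.
move=> A p q u w hu hw n d v hv.
rewrite (Psi_degE (aff_deg_bracket hu hw) hv) poddD.
set L := map _ _; pose h i := (d i, v i).
have LE : L = map (@plab K A) (map h (enum 'I_n)) by rewrite -(map_comp (@plab K A) h).
have hh r : all (@homogl K A) (map h r).
  by apply/allP => _ /mapP[i _ ->]; apply: hv.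
have E p1 q1 (u1 w1 : aff A) : aff_deg p1 u1 -> aff_deg q1 w1 ->
    nr_mul (fun k => Psi A k u1) (fun k => Psi A k w1) d v =
    lop_nr (podd q1) (psi (podd p1) u1.1 u1.2) (psi (podd q1) w1.1 w1.2) L.
  move=> hu1 hw1; rewrite nr_mulE /lop_nr LE ush_plab [RHS](ush_map (labU := podd \o d)) //.
  apply: eq_ush => a b; rewrite (_ : map v a = map snd (map h a)); last by rewrite -map_comp.
  rewrite (_ : map v b = map snd (map h b)); last by rewrite -map_comp.
  rewrite (Psi_on_list hw1 (hh a)) parity_plab -poddD.
  (* By [ldeg_psi] the inner value is homogeneous, so it can stand as first argument with its degree
     as label. *)
  have := @Psi_on_list _ _ u1 ((degl (map h a) + q1, psi (podd q1) w1.1 w1.2 (map (@plab K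
    A) (map h a))) :: map h b) hu1.
  by apply; rewrite /= hh andbT; case: hw1 => hw11 hw12; apply: ldeg_psi.
rewrite /nr_bracket (E p q) // (E q p) // dsign_sg.
have := psi_Jacobi (podd p) (podd q) u.1 w.1 (gend_linear u.2) (gend_linear w.2).
move/(congr1 (fun F => F L)) => H; etransitivity; last etransitivity; [|exact: H|].
  congr (psi _ _ _ L); first by rewrite /= dsign_sg.
  by apply/funext => a /=; rewrite -dsign_sg.
by rewrite -[LHS]/(_ - _); congr (_ - _); case: (_ && _).
Qed.

Lemma Psi_natural : naturality (@Psi K).
Proof.
move=> A B alpha Ha x f g fg n v; have [la _ _ ha] := Ha.
have E y (f' : A -> A) (g' : B -> B) : (forall a, g' (alpha a) = alpha (f' a)) ->
    alpha (psi_op y f' v) = psi_op (alpha y) g' [ffun i => alpha (v i)].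
  move=> fg'; rewrite /psi_op (lin_sum la); apply: eq_bigr => e _.
  rewrite /op_of_lop (lin_sum la); apply: eq_bigr => b _.
  rewrite (psi_nat Ha _ _ (g := epar e g')).
    rewrite -map_comp (gpar_morph _ _ la ha); congr psi; apply: eq_map => i /=.
    by rewrite ffunE (gpar_morph _ _ la ha).
  by move=> a; rewrite !eparE (linD la) !(gpar_morph _ _ la ha) -!fg' !(gpar_morph _ _ la ha).
split; first by rewrite !PsiE; apply: E => a; rewrite (lin0 la).
by rewrite !PsiE /= (E _ _ _ fg) (lin0 la).
Qed.

Lemma Psi_one_deg (A : gradedAlgType K) : aff_deg 0 (aff_vec (gone : A)).
Proof. by split; [apply: gone_deg | apply: end_deg0]. Qed.

Lemma Psi_id_deg (A : gradedAlgType K) : aff_deg 0 (aff_end (gend_id A)).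
Proof. by split; [apply: homog0 | split=> [//|i v]; rewrite addr0]. Qed.

Lemma Psi_idE (A : gradedAlgType K) n (v : {ffun 'I_n.+1 -> A}) :
  Psi A n.+1 (aff_end (gend_id A)) v = 0.
Proof.
have [h1 h2] := Psi_id_deg A.
rewrite PsiE (psi_op_homog _ h1 h2) (psi_id charK) /op_of_lop big1 // => b _.
by rewrite enum_ordSl.
Qed.

Lemma map_enum_ordSr (T : Type) n (h : 'I_n.+1 -> T) :
  [seq h i | i <- enum 'I_n.+1] =
  rcons [seq h (widen_ord (leqnSn n) i) | i <- enum 'I_n] (h ord_max).
Proof. by rewrite enum_ordSr map_rcons -map_comp. Qed.

Lemma upd_widen (A : gradedAlgType K) n (v : {ffun 'I_n.+1 -> A}) z i :
  upd v ord_max z (widen_ord (leqnSn n) i) = v (widen_ord (leqnSn n) i).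
Proof.
by rewrite ffunE; case: eqP => // /(congr1 val) /= e; have := ltn_ord i; rewrite e ltnn.
Qed.

Lemma multilinear_updM (A : gradedAlgType K) n (f : {ffun 'I_n.+1 -> A} -> A) c :
  multilinear f -> multilinear (fun v => f (upd v ord_max (gmul (v ord_max) c))).
Proof.
move=> lf v i a x y; have [->|ni] := eqVneq i ord_max.
  have E z : upd (upd v ord_max z) ord_max (gmul (upd v ord_max z ord_max) c) =
      upd v ord_max (gmul z c).
    by apply/ffunP => j; rewrite !ffunE eqxx; case: eqP.
  by rewrite !E gmulDl gmulZl lf.
have E z : upd (upd v i z) ord_max (gmul (upd v i z ord_max) c) =
    upd (upd v ord_max (gmul (v ord_max) c)) i z.
  apply/ffunP => j; rewrite !ffunE [ord_max == i]eq_sym (negPf ni).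
  by case: (eqVneq j i) => [->|]; rewrite ?(negPf ni).
by rewrite !E lf.
Qed.

(** [Psi_Id] vanishes in positive arity. For [Psi_1] both sides are multilinear in the arguments, so
    homogeneous ones suffice, and there it is [sexpN]. *)
Lemma Psi_base_change : base_change (@Psi K).
Proof.
move=> A k c hc cC n v vc; rewrite {}/vc; split; last by rewrite !Psi_idE gmul0l.
have [lP _ _] := Psi_degree (Psi_one_deg A) n.+1.
move: v; apply: multilinear_eq; first exact: multilinear_updM.
  by move=> v i a x y; rewrite lP gmulDl gmulZl.
move=> d v hv; set v' := upd _ _ _.
have hv' : has_degs (fun i => if i == ord_max then d i + k else d i) v'.
  by move=> i; rewrite ffunE; case: eqP => [->|_]; rewrite ?gmul_deg.
rewrite (Psi_degE (Psi_one_deg A) hv) (Psi_degE (Psi_one_deg A) hv') (psi_one charK).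
rewrite !map_enum_ordSr eqxx /v' [upd _ _ _ ord_max]ffunE eqxx.
pose l := [seq (d (widen_ord (leqnSn n) i), v (widen_ord (leqnSn n) i)) | i <- enum 'I_n].
rewrite (_ : [seq (podd (if _ then _ else _), _) | i <- _] = map (@plab K A) l); last first.
  rewrite /l -(map_comp (@plab K A)); apply: eq_map => i /=; rewrite upd_widen;
    case: eqP => // /(congr1 val) /= e.
  by have := ltn_ord i; rewrite e ltnn.
rewrite (_ : [seq (podd (d _), _) | i <- _] = map (@plab K A) l);
  last by rewrite /l -(map_comp (@plab K A)).
apply: (clinear_sexpN cC) => //.
by apply/allP => _ /mapP[i _ ->]; apply: hv.
Qed.

Lemma Psi_initial : initial_terms (@Psi K).
Proof.
move=> A x f v; have hv : has_degs (fun _ => 0) v by case.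
have E y (g : A -> A) : linear g ->
    psi_op y g v = \sum_(e : bool) (gpar e y + epar e g gone).
  move=> lg; apply: eq_bigr => e _; rewrite (op_of_lop_homog _ hv).
    by rewrite enum_ord0 psi0.
  by apply: mlin_psi; apply: epar_linear.
split.
  rewrite PsiE E ?big_bool /=; last by move=> k a b; rewrite scaler0 addr0.
  rewrite /epar !big1 ?addr0 => [|c _|c _]; try by rewrite (lin0 (gpar_linear _)).
  by rewrite addrC gparD.
rewrite PsiE E ?big_bool /=; last exact: gend_linear.
rewrite !(lin0 (gpar_linear _)) !add0r !eparE !(gpar_homog _ (@gone_deg K A)) /=.
by rewrite linear0 !(lin0 (gpar_linear _)) !add0r addrC gparD.
Qed.

Lemma Psi_gauge : gauge_fixing (@Psi K).
Proof. by case=> // n _; apply: val_inj; apply/funext => v; exact: Psi_idE. Qed.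

Lemma Psi_higher_koszul : higher_koszul (@Psi K).
Proof.
split; [exact: Psi_degree | exact: Psi_Jacobi | exact: Psi_natural
  | exact: Psi_base_change | exact: Psi_initial | exact: Psi_gauge].
Qed.

End PsiConditions.

Section SymopTheory.
Variables (K : fieldType) (V : gradedLmodType K) (n : nat).

Lemma symopB (f g : symop n V) v : (f - g) v = f v - g v. Proof. by []. Qed.
Lemma symop0 v : (0 : symop n V) v = 0. Proof. by []. Qed.

Lemma symop_multilinear (f : symop n V) : multilinear f.
Proof.
case: f => f /= /asboolP; elim/deg_sum_ind => [|k g h [lg _ _] lh] v i a x y.
  by change (0 = a *: 0 + 0 :> V); rewrite scaler0 addr0.
rewrite -[LHS]/(g _ + h _) lg lh addrACA -scalerDr.
by [].
Qed.

Lemma symop_gsym (f : symop n V) : graded_symmetric f.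
Proof.
case: f => f /= /asboolP; elim/deg_sum_ind => [|k g h [_ sg_ _] sh] d v s hv.
  by change (0 = ksign K s d *: 0 :> V); rewrite scaler0.
by rewrite -[LHS]/(g _ + h _) (sg_ _ _ s hv) (sh _ _ s hv) -scalerDr.
Qed.

Lemma symop_eq (f g : symop n V) : (forall v, f v = g v) -> f = g.
Proof. by move=> fg; apply: val_inj; apply/funext. Qed.
End SymopTheory.

(** The only inversion of an adjacent transposition is the pair that it exchanges. *)
Lemma ksign_tperm (K : fieldType) n (i j : 'I_n) (d : 'I_n -> int) :
  j = i.+1 :> nat -> ksign K (tperm i j) d = (-1) ^+ (podd (d i) && podd (d j)).
Proof.
move=> ij; rewrite /ksign.
rewrite (_ : [set _ | _] = if podd (d i) && podd (d j) then [set (i, j)] else set0).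
  by case: ifP; rewrite ?cards1 ?cards0.
apply/setP => -[a b]; rewrite inE /= poddM.
have -> : (a < b)%N && ((tperm i j b < tperm i j a)%N && (podd (d (tperm i j a)) && podd (d
  (tperm i j b)))) =
    [&& a == i, b == j & podd (d j) && podd (d i)].
  rewrite andbA; have -> : (a < b)%N && (tperm i j b < tperm i j a)%N = (a == i) && (b == j).
    have tv z : tperm i j z = (if z == i :> nat then j : nat else if z == j :> nat then i :
      nat else z) :> nat.
      by case: (tpermP i j z) => [->|->|/eqP zi /eqP zj];
        rewrite !val_eqE ?eqxx ?(negPf zi) ?(negPf zj) //; case: eqP => // ->.
    rewrite !tv -[a == i]val_eqE -[b == j]val_eqE /=;
      move: (nat_of_ord a) (nat_of_ord b) (nat_of_ord i) (nat_of_ord j) ij => a' b' i' j' ->;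
    case: (a' =P i') => ?; case: (a' =P i'.+1) => ?; case: (b' =P i') => ?;
      case: (b' =P i'.+1) => ?; lia.
  by rewrite -andbA; case: eqP => //= ->; case: eqP => //= ->; rewrite tpermL tpermR.
case: ifP => [/andP[-> ->]|]; first by rewrite !andbT !inE.
by rewrite andbC => ->; rewrite !andbF inE.
Qed.

Section OnList.
Variables (K : fieldType) (V : gradedLmodType K) (F : forall n, symop n V).

Lemma on_list_nth x0 n (l : seq V) : size l = n -> on_list F l = F n [ffun i : 'I_n => nth
  x0 l i].
Proof.
by case: n /; congr (F _ _); apply/ffunP => i; rewrite !ffunE (tnth_nth x0).
Qed.

Lemma on_list_mlin l1 k x y l2 :
  on_list F (l1 ++ (k *: x + y) :: l2) =
  k *: on_list F (l1 ++ x :: l2) + on_list F (l1 ++ y :: l2).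
Proof.
pose n := (size l1 + (size l2).+1)%N.
have iP : (size l1 < n)%N by rewrite /n addnS ltnS leq_addr.
rewrite !(@on_list_nth 0 n) ?size_cat //.
have E z : [ffun i : 'I_n => nth 0 (l1 ++ z :: l2) i] =
   upd [ffun i : 'I_n => nth 0 (l1 ++ 0 :: l2) i] (Ordinal iP) z.
  apply/ffunP => j; rewrite !ffunE !nth_cat; case: eqP => [->|/eqP];
    first by rewrite /= ltnn subnn.
  rewrite -val_eqE /=; case: ltngtP => // lt _.
  by rewrite -(subnSK lt).
by rewrite (E (k *: x + y)) (E x) (E y) symop_multilinear.
Qed.

Lemma on_list_zero l1 l2 : on_list F (l1 ++ 0 :: l2) = 0.
Proof.
have := on_list_mlin l1 1 0 0 l2; rewrite scale1r addr0 scale1r.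
by move/eqP; rewrite -subr_eq0 opprD addNKr oppr_eq0 => /eqP.
Qed.

Lemma on_listN l1 x l2 : on_list F (l1 ++ - x :: l2) = - on_list F (l1 ++ x :: l2).
Proof. by rewrite -[- x]addr0 -scaleN1r on_list_mlin on_list_zero addr0 scaleN1r. Qed.

Lemma on_listD l1 x y l2 :
  on_list F (l1 ++ (x + y) :: l2) = on_list F (l1 ++ x :: l2) + on_list F (l1 ++ y :: l2).
Proof. by rewrite -[x in x + y]scale1r on_list_mlin scale1r. Qed.

Lemma on_list_swap (T : Type) (d : T -> int) (v : T -> V) :
  (forall t, v t \in homog (d t)) ->
  gsym (podd \o d) (fun r => on_list F (map v r)).
Proof.
move=> hv l1 x y l2; pose n := (size l1 + (size l2).+2)%N.
have iP : (size l1 < n)%N by rewrite /n; lia.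
have jP : ((size l1).+1 < n)%N by rewrite /n; lia.
pose s := tperm (Ordinal iP) (Ordinal jP).
pose l := l1 ++ x :: y :: l2.
have sz z : size (map v (l1 ++ z)) = (size l1 + size z)%N by rewrite size_map size_cat.
rewrite !(@on_list_nth 0 n) ?sz //.
have hd : has_degs (fun i : 'I_n => d (nth x l i)) [ffun i : 'I_n => nth 0 (map v l) i].
  by move=> i; rewrite ffunE (nth_map x) ?hv // size_cat /= ltn_ord.
rewrite (symop_gsym _ s hd) ksign_tperm //= signr_sg /l !nth_cat ltnn subnn ltnNge leqnSn /=
  subSnn /= oddb.
congr (sg _ (F n _)); apply/ffunP => i; rewrite !ffunE /s !map_cat !nth_cat size_map.
case: tpermP => [->|->|/eqP ni /eqP nj] /=.
- by rewrite ltnn ltnNge leqnSn /= subSnn subnn.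
- by rewrite ltnn ltnNge leqnSn /= subSnn subnn.
move: ni nj; rewrite -[i == _]val_eqE -[i == Ordinal jP]val_eqE /= => ni nj;
  case: ltnP => // li.
have [k ->] : exists k, i = ((size l1).+2 + k)%N :> nat.
  by exists (i - (size l1).+2)%N; rewrite subnKC //; lia.
by rewrite !addSn -!addnS addKn.
Qed.

End OnList.

Lemma on_list_sub (K : fieldType) (V : gradedLmodType K) (F G : forall n, symop n V) l :
  on_list (fun n => F n - G n) l = on_list F l - on_list G l.
Proof. by []. Qed.

(** * Natural operators that are linear over the centre *)

Section Twist.
Variables (K : fieldType) (A : gradedAlgType K).
Implicit Types (x y : A).

(* x |-> t x t^-1 for a graded central t of parity e. *)
Definition twist (e : bool) x : A := gpar false x + sg e (gpar true x).

Lemma twist_linear e : linear (twist e).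
Proof.
by move=> k x y; rewrite /twist !gpar_linear sgD sgZ scalerDr addrACA.
Qed.

Lemma twist_homog e i x : x \in homog i -> twist e x = sg (e && podd i) x.
Proof.
move=> hx; rewrite /twist !(gpar_homog _ hx).
by case: (podd i); case: e; rewrite ?sg0 ?addr0 ?add0r.
Qed.

Lemma twist_deg e i x : x \in homog i -> twist e x \in homog i.
Proof. by move=> hx; rewrite (twist_homog _ hx) homog_sg. Qed.

Lemma twist_one e : twist e gone = gone :> A.
Proof. by rewrite (twist_homog _ (@gone_deg K A)) andbF. Qed.

Lemma twistM e x y : twist e (gmul x y) = gmul (twist e x) (twist e y).
Proof.
have lt := twist_linear e.
move: x; apply: homog_eq => [k u v|k u v|i x hx]; first by rewrite gmulDl gmulZl lt.
  by rewrite lt gmulDl gmulZl.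
move: y; apply: homog_eq => [k u v|k u v|j y hy]; first by rewrite gmulDr gmulZr lt.
  by rewrite lt gmulDr gmulZr.
rewrite (twist_homog _ hx) (twist_homog _ hy) (twist_homog _ (gmul_deg _ _ _ _ hx hy)).
by rewrite gmul_sgl gmul_sgr sgK poddD andb_addr.
Qed.

End Twist.

(* The graded algebra A[t]/(t^2), with t graded central of degree -d; the pair
   (a, b) stands for a + b t. *)
Definition dual (K : fieldType) (A : gradedAlgType K) (d : int) : Type := (A * A)%type.

Section DualNumbers.
Variables (K : fieldType) (A : gradedAlgType K) (d : int).
Notation B := (dual A d).

HB.instance Definition _ := GRing.Lmodule.on B.

(** As t has degree [-d], the component of [b t] in degree [i] comes from that of [b] in degree
    [i + d]. *)
Let dproj (i : int) (x : B) : B := (gproj i x.1, gproj (i + d) x.2).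

Fact dproj_linear i : linear (dproj i).
Proof. by move=> k x y; rewrite /dproj /= !linearP. Qed.

Fact dprojK i j x : dproj i (dproj j x) = if i == j then dproj j x else 0.
Proof.
rewrite /dproj /= !gprojK (inj_eq (addIr d)).
by case: eqP.
Qed.

Fact dproj_sum x : exists s : seq int, uniq s /\ x = \sum_(i <- s) dproj i x.
Proof.
pose s := undup (gsupp x.1 ++ [seq i - d | i <- gsupp x.2]).
exists s; split; first exact: undup_uniq.
have big1E (r : seq int) : (\sum_(i <- r) dproj i x) =
    (\sum_(i <- r) gproj i x.1, \sum_(i <- r) gproj (i + d) x.2).
  by elim: r => [|i r IHr]; rewrite ?big_nil // !big_cons IHr.
have sup (T : seq int) (v : A) : uniq T -> (forall j, j \notin T -> gproj j v = 0) ->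
    v = \sum_(i <- T) gproj i v.
  move=> uT T0; rewrite -[LHS]gparD (gparE _ uT T0) (gparE _ uT T0).
  rewrite [RHS](bigID (fun i => podd i == false)) /=; congr (_ + _).
  by apply: eq_bigl => i; case: (podd i).
rewrite big1E [LHS]surjective_pairing; congr (_, _).
  apply: sup => [|j]; first exact: undup_uniq.
  by rewrite mem_undup mem_cat negb_or => /andP[+ _]; apply: gproj_notin (gsupp_sum _).
rewrite -(big_map (fun i => i + d) predT (fun i => gproj i x.2)).
apply: sup => [|j]; first by rewrite map_inj_uniq ?undup_uniq //; apply: addIr.
move=> Hj; apply: gproj_notin (gsupp_sum _) _; apply: contra Hj => Hj.
by apply/mapP; exists (j - d); rewrite ?subrK // mem_undup mem_cat (map_f (fun i => i - d)
  Hj) orbT.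
Qed.

HB.instance Definition _ := Lmodule_isGraded.Build K B dproj_linear dprojK dproj_sum.

Lemma dual_homog i (x : B) : (x \in homog i) = (x.1 \in homog i) && (x.2 \in homog (i + d)).
Proof. by []. Qed.

Definition dual_one : B := (gone, 0).
(** The product multiplied out with [t a = twist (podd d) a t] and [t^2 = 0]. *)
Definition dual_mul (x y : B) : B :=
  (gmul x.1 y.1, gmul x.1 y.2 + gmul x.2 (twist (podd d) y.1)).

Fact dual_mulA : associative dual_mul.
Proof.
move=> x y z; rewrite /dual_mul /= twistM.
move: (twist _ y.1) (twist _ z.1) => ty tz.
by rewrite !gmulDr !gmulDl !gmulA addrA.
Qed.

Fact dual_mul1l : left_id dual_one dual_mul.
Proof. by case=> a b; rewrite /dual_mul /= !gmul1l gmul0l addr0. Qed.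

Fact dual_mul1r : right_id dual_one dual_mul.
Proof. by case=> a b; rewrite /dual_mul /= twist_one !gmul1r gmul0r add0r. Qed.

Fact dual_linearl y : linear (fun x => dual_mul x y).
Proof.
move=> k u v; rewrite /dual_mul -[RHS]/(_, _) /=; move: (twist _ y.1) => ty.
by congr (_, _); rewrite !gmulDl !gmulZl // addrACA -scalerDr.
Qed.

Fact dual_linearr x : linear (dual_mul x).
Proof.
move=> k u v; rewrite /dual_mul -[RHS]/(_, _) /= twist_linear.
move: (twist _ u.1) (twist _ v.1) => tu tv.
by congr (_, _); rewrite !gmulDr !gmulZr // addrACA -scalerDr.
Qed.

Fact dual_one_deg : dual_one \in homog 0.
Proof. by rewrite dual_homog gone_deg homog0. Qed.

Fact dual_mul_deg i j x y : x \in homog i -> y \in homog j -> dual_mul x y \in homog (i + j).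
Proof.
rewrite !dual_homog => /andP[x1 x2] /andP[y1 y2]; rewrite gmul_deg //=.
apply: homogD; first by rewrite -addrA gmul_deg.
by rewrite addrAC gmul_deg // twist_deg.
Qed.

HB.instance Definition _ := GradedLmodule_isGradedAlgebra.Build K B
  dual_mulA dual_mul1l dual_mul1r dual_linearl dual_linearr dual_one_deg dual_mul_deg.

Definition dual_in (a : A) : B := (a, 0).
Definition dual_t : B := (0, gone).

Lemma dual_in_morphism : galg_morphism dual_in.
Proof.
split=> [k x y||x y|i x hx] //.
- by rewrite /dual_in -[RHS]/(_, _) /= scaler0 addr0.
- by rewrite -[RHS]/(_, _) /= gmul0r gmul0l addr0.
- by rewrite dual_homog hx homog0.
Qed.

Lemma dual_t_deg : dual_t \in homog (- d).
Proof. by rewrite dual_homog homog0 addNr gone_deg. Qed.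

Lemma gmul_dual_t (x : B) : gmul x dual_t = (0, x.1).
Proof. by rewrite -[LHS]/(_, _) /= gmul0r gmul1r (lin0 (twist_linear _)) gmul0r addr0. Qed.

Lemma dual_t_central i (x : B) : x \in homog i ->
  gmul x dual_t = dsign K i (- d) *: gmul dual_t x.
Proof.
rewrite dual_homog => /andP[x1 _]; rewrite gmul_dual_t dsign_sg.
rewrite -[gmul dual_t x]/(_, _) /= !gmul0l add0r gmul1l (twist_homog _ x1).
have -> : podd (- d) = podd d by rewrite /podd abszN.
rewrite andbC; case: (podd d && podd i) => //.
by rewrite /sg -[RHS]/(_, _) /= oppr0 opprK.
Qed.

End DualNumbers.

(** Placed in degree 0, K[X] is entirely graded central, so base change applies to X, while X can be
    sent to any element of degree 0. *)
Definition gpoly (K : fieldType) : Type := {poly K}.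

Section Polynomials.
Variables (K : fieldType).
Notation P := (gpoly K).

HB.instance Definition _ := GRing.Lmodule.on P.

Let pproj (i : int) (x : P) : P := if i == 0 then x else 0.

Fact pproj_linear i : linear (pproj i).
Proof. by move=> a x y; rewrite /pproj; case: ifP => // _; rewrite scaler0 addr0. Qed.

Fact pprojK i j x : pproj i (pproj j x) = if i == j then pproj j x else 0.
Proof.
rewrite /pproj; have [->|ne0i] := eqVneq i 0; last first.
  by case: (i =P j) => // <-; rewrite (negPf ne0i).
by rewrite eq_sym; case: eqP.
Qed.

Fact pproj_sum x : exists s : seq int, uniq s /\ x = \sum_(i <- s) pproj i x.
Proof. by exists [:: 0]; rewrite big_seq1 /pproj eqxx. Qed.

HB.instance Definition _ := Lmodule_isGraded.Build K P pproj_linear pprojK pproj_sum.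

Lemma gpoly_homog0 (x : P) : x \in homog 0.
Proof. exact: eqxx. Qed.

Lemma gpoly_homogN0 i (x : P) : i != 0 -> x \in homog i -> x = 0.
Proof. by move=> i0 /eqP <-; rewrite /gproj /= /pproj (negPf i0). Qed.

Let pmul (x y : P) : P := (x : {poly K}) * y.

Fact pmulA : associative pmul. Proof. exact: mulrA. Qed.
Fact pmul1l : left_id (1 : {poly K}) pmul. Proof. exact: mul1r. Qed.
Fact pmul1r : right_id (1 : {poly K}) pmul. Proof. exact: mulr1. Qed.
Fact pmul_linl y : linear (fun x => pmul x y).
Proof. by move=> a u v; rewrite /pmul mulrDl -[(a *: _) * _](scalerAl a (u : {poly K})). Qed.
Fact pmul_linr x : linear (pmul x).
Proof. by move=> a u v; rewrite /pmul mulrDr -[_ * (a *: _)](scalerAr a (x : {poly K})). Qed.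
Fact pone_deg : (1 : {poly K}) \in @homog K P 0. Proof. exact: gpoly_homog0. Qed.
Fact pmul_deg i j (x y : P) : x \in homog i -> y \in homog j -> pmul x y \in homog (i + j).
Proof.
have [->|i0] := eqVneq i 0; last by move/(gpoly_homogN0 i0) => ->; rewrite /pmul mul0r homog0.
have [->|j0] := eqVneq j 0; first by move=> _ _; rewrite addr0 gpoly_homog0.
by move=> _ /(gpoly_homogN0 j0) ->; rewrite /pmul mulr0 homog0.
Qed.

HB.instance Definition _ := GradedLmodule_isGradedAlgebra.Build K P
  pmulA pmul1l pmul1r pmul_linl pmul_linr pone_deg pmul_deg.

Lemma polyC_morphism : galg_morphism (fun c : K^o => c%:P : P).
Proof.
split=> [k x y||x y|i x hx] //.
- by rewrite polyCD -mul_polyC -polyCM.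
- exact: polyCM.
have [->|i0] := eqVneq i 0; first exact: gpoly_homog0.
suff -> : x = 0 by rewrite polyC0 homog0.
by move/eqP: hx => <-; rewrite /gproj /= (negPf i0).
Qed.

Variables (A : gradedAlgType K) (a : A) (ha : a \in homog 0).

Definition gpow n : A := iter n (gmul a) gone.
Definition peval (p : P) : A := \sum_(i < size (p : {poly K})) (p : {poly K})`_i *: gpow i.

Lemma pevalE n (p : P) : (size (p : {poly K}) <= n)%N ->
  peval p = \sum_(i < n) (p : {poly K})`_i *: gpow i.
Proof.
move=> pn; rewrite /peval (big_ord_widen n (fun i => (p : {poly K})`_i *: gpow i) pn).
rewrite big_mkcond; apply: eq_bigr => i _; case: ltnP => // pi.
by rewrite nth_default // scale0r.
Qed.

Lemma peval_linear : linear peval.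
Proof.
move=> k p q; pose n := maxn (size (p : {poly K})) (size (q : {poly K})).
rewrite (@pevalE n p) ?leq_maxl // (@pevalE n q) ?leq_maxr // (@pevalE n).
  rewrite scaler_sumr -big_split; apply: eq_bigr => i _ /=.
  by rewrite coefD coefZ scalerDl scalerA.
by rewrite (leq_trans (size_polyD _ _)) // geq_max leq_maxr andbT (leq_trans (size_scale_leq
  _ _)) ?leq_maxl.
Qed.

Lemma peval_mulX (p : {poly K}) : peval (p * 'X) = gmul a (peval p).
Proof.
have sp : (size (p * 'X)%R <= (size p).+1)%N.
  by rewrite (leq_trans (size_polyMleq _ _)) // size_polyX addn2.
rewrite (pevalE sp) big_ord_recl coefMX eqxx scale0r add0r.
by rewrite linear_sum; apply: eq_bigr => i _; rewrite coefMX /= linearZ.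
Qed.

Lemma gmul_gpowC n : gmul (gpow n) a = gmul a (gpow n).
Proof. by elim: n => [|n IHn] /=; rewrite ?gmul1l ?gmul1r // -gmulA IHn. Qed.

Lemma peval_comm p : gmul (peval p) a = gmul a (peval p).
Proof.
rewrite -[LHS]/(gmulr a _) !linear_sum; apply: eq_bigr => i _ /=.
by rewrite !linearZ /= /gmulr gmul_gpowC.
Qed.

Lemma pevalC c : peval (c%:P : {poly K}) = c *: gone.
Proof.
by rewrite (@pevalE 1) ?size_polyC_leq1 // big_ord1 coefC eqxx.
Qed.

Lemma pevalX : peval 'X = a.
Proof. by rewrite -['X]mul1r peval_mulX -[1]/(1%:P) pevalC scale1r gmul1r. Qed.

(** [A] may be noncommutative, but only powers of the single element [a] get multiplied, and
    [peval_comm] moves [a] across them. *)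
Lemma pevalM (p q : {poly K}) : peval (p * q) = gmul (peval p) (peval q).
Proof.
elim/poly_ind: p q => [|p c IHp] q; first by rewrite mul0r (lin0 peval_linear) gmul0l.
rewrite mulrDl (linD peval_linear) -mulrA [_ * q]mulrC IHp peval_mulX gmulA peval_comm.
rewrite mul_polyC (linZ peval_linear) (linD peval_linear) peval_mulX pevalC gmulDl gmulZl.
by rewrite gmul1l.
Qed.

Lemma gpow_deg n : gpow n \in homog 0.
Proof. by elim: n => [|n IHn]; [apply: gone_deg | rewrite -[0]addr0 gmul_deg]. Qed.

Lemma peval_morphism : galg_morphism peval.
Proof.
split=> [||x y|i x].
- exact: peval_linear.
- by rewrite -[gone]/(1%:P) pevalC scale1r.
- exact: pevalM.
have [->|i0 /(gpoly_homogN0 i0) ->] := eqVneq i 0; last first.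
  by rewrite (lin0 peval_linear) homog0.
move=> _; rewrite /peval; elim/big_ind: _ => [|u v|j _]; first exact: homog0.
  exact: homogD.
exact/homogZ/gpow_deg.
Qed.

End Polynomials.

Lemma on_list_move (K : fieldType) (V : gradedLmodType K) (F : forall n, symop n V)
    (l1 r1 r2 : seq (int * V)) x : all (@homogl K V) (l1 ++ x :: r1 ++ r2) ->
  on_list F (map snd (l1 ++ x :: r1 ++ r2)) =
  sg (podd x.1 && podd (degl r1)) (on_list F (map snd (l1 ++ r1 ++ x :: r2))).
Proof.
(* [on_list_swap] wants homogeneous values on the whole index type. Projecting to the labelled
   degree achieves this and changes nothing on lists in [homogl]. *)
pose v (y : int * V) := gproj y.1 y.2.
have vE l : all (@homogl K V) l -> map snd l = map v l.
  by elim: l => //= y l IHl /andP[/eqP hy /IHl ->]; rewrite /v hy.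
move=> hl; have hl' : all (@homogl K V) (l1 ++ r1 ++ x :: r2).
  by move: hl; rewrite !all_cat /= !all_cat /= => /and4P[-> -> -> ->].
have vs : gsym (podd \o fst) (fun r => on_list F (map v r)).
  by apply: on_list_swap => y; apply: homog_gproj.
rewrite (vE _ hl) (vE _ hl') (gsym_move _ _ _ _ vs); congr (sg (_ && _) _).
by elim: (r1) => [|y l IHl] /=; rewrite ?degl_cons ?poddD ?IHl // /degl big_nil.
Qed.

(** * Vanishing of natural families *)

Section Vanishing.
Variables (K : fieldType) (charK : [pchar K] =i pred0).
Variable D : forall (A : gradedAlgType K) (n : nat), symop n A.
Hypothesis Dnat : forall (A B : gradedAlgType K) (alpha : A -> B), galg_morphism alpha ->
  forall n v, alpha (D A n v) = D B n [ffun i => alpha (v i)].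
Hypothesis Dbase : forall (A : gradedAlgType K) k (c : A), c \in homog k ->
  (forall i a, a \in homog i -> gmul a c = dsign K i k *: gmul c a) ->
  forall n (v : {ffun 'I_n.+1 -> A}),
  D A n.+1 (upd v ord_max (gmul (v ord_max) c)) = gmul (D A n.+1 v) c.
Hypothesis D1 : forall n, D K^o n [ffun => 1] = 0.

Let DL (A : gradedAlgType K) : seq A -> A := on_list (D A).

Let DL_nat (A B : gradedAlgType K) (alpha : A -> B) l : galg_morphism alpha ->
  alpha (DL l) = DL (map alpha l).
Proof.
move=> Ha; rewrite /DL (@on_list_nth _ _ _ (alpha 0) (size l)) ?size_map //.
rewrite (@on_list_nth _ _ _ 0 (size l)) // Dnat //; congr (D B _ _).
by apply/ffunP => i; rewrite !ffunE (nth_map 0).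
Qed.

Let DL_base (A : gradedAlgType K) k (c : A) l x : c \in homog k ->
  (forall i a, a \in homog i -> gmul a c = dsign K i k *: gmul c a) ->
  DL (rcons l (gmul x c)) = gmul (DL (rcons l x)) c.
Proof.
move=> hc cC; rewrite /DL !(@on_list_nth _ _ _ 0 (size l).+1) ?size_rcons //.
rewrite -(Dbase hc cC); congr (D A _ _); apply/ffunP => i; rewrite !ffunE !nth_rcons ltnn eqxx.
have [->|ni] := eqVneq i ord_max; first by rewrite /= ltnn eqxx.
case: ltngtP => // e.
by case/eqP: ni; apply: val_inj.
Qed.

Let Dl (A : gradedAlgType K) (l : seq (int * A)) : A := DL (map snd l).

Let move0 (A : gradedAlgType K) (l1 r1 r2 : seq (int * A)) (a : A) :
  all (@homogl K A) (l1 ++ (0, a) :: r1 ++ r2) ->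
  Dl (l1 ++ (0, a) :: r1 ++ r2) = Dl (l1 ++ r1 ++ (0, a) :: r2).
Proof. by move=> hl; rewrite /Dl /DL on_list_move. Qed.

Let all_nseq0 (A : gradedAlgType K) n (a : A) : a \in homog 0 ->
  all (@homogl K A) (nseq n (0, a)).
Proof. by move=> ha; rewrite all_nseq /homogl /= ha orbT. Qed.

(** Base change by X turns an X in the last slot into 1 with a factor X outside. Once all are
    removed, the arguments are units and come from [K] by naturality. *)
Let Dl_polyX m n : Dl (nseq m (0 : int, 'X : gpoly K) ++ nseq n (0 : int, 1 : gpoly K)) = 0.
Proof.
elim: m n => [|m IHm] n.
  have := @DL_nat K^o (gpoly K) _ (nseq n 1) (@polyC_morphism K).
  rewrite /Dl !map_nseq => <-; rewrite /DL (@on_list_nth _ _ _ 0 n) ?size_nseq //.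
  rewrite (_ : [ffun _ => _] = [ffun => 1]) ?D1 ?polyC0 //.
  by apply/ffunP => i; rewrite !ffunE nth_nseq ltn_ord.
have := @move0 (gpoly K) [::] (nseq m (0, 'X : gpoly K) ++ nseq n (0, 1 : gpoly K)) [::] 'X.
rewrite !cats0 /= => ->; last first.
  by rewrite /homogl gpoly_homog0 all_cat !all_nseq0 ?gpoly_homog0.
rewrite /Dl cats1 map_rcons /=; set L := map _ _.
rewrite -[X in rcons L X](mul1r ('X : {poly K})).
rewrite (@DL_base _ 0 ('X : gpoly K) _ (1 : {poly K})) ?gpoly_homog0 //; last first.
  move=> i p hp; rewrite dsign_sg andbF; exact: mulrC.
have := IHm n.+1; rewrite -[n.+1]addn1 nseqD /= catA cats1 /Dl map_rcons /= -/L => ->.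
by rewrite gmul0l.
Qed.

Let Dl_diag (A : gradedAlgType K) n (a : A) : a \in homog 0 -> Dl (nseq n (0, a)) = 0.
Proof.
move=> ha; have := @DL_nat (gpoly K) A _ (nseq n 'X) (peval_morphism ha).
rewrite map_nseq pevalX /Dl map_nseq => <-.
have := Dl_polyX n 0; rewrite /Dl cats0 map_nseq => ->.
exact: (lin0 (peval_linear a)).
Qed.

(* The degree one part of the binomial expansion, when u occurs at most once. *)
Let Dl_expand (A : gradedAlgType K) m (l : seq (int * A)) (a u : A) :
  a \in homog 0 -> u \in homog 0 -> all (@homogl K A) l ->
  (forall l1 l2, all (@homogl K A) l1 -> all (@homogl K A) l2 ->
     Dl (l1 ++ (0, u) :: l2 ++ [:: (0, u)]) = 0) ->
  Dl (l ++ nseq m (0, a + u)) =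
  Dl (l ++ nseq m (0, a)) + Dl (l ++ nseq m.-1 (0, a) ++ [:: (0, u)]) *+ m.
Proof.
move=> ha hu + uu; elim: m l => [|m IHm] l hl; first by rewrite mulr0n addr0.
have -> : Dl (l ++ nseq m.+1 (0, a + u)) =
    Dl (rcons l (0, a) ++ nseq m (0, a + u)) + Dl (rcons l (0, u) ++ nseq m (0, a + u)).
  by rewrite /Dl !map_cat !map_rcons !cat_rcons /= /DL on_listD.
rewrite !IHm ?all_rcons ?hl /homogl /= ?ha ?hu // -addrA; congr (_ + _).
  by rewrite cat_rcons.
rewrite !cat_rcons (uu l) ?all_nseq0 // mul0rn addr0 [in RHS]mulrS addrC.
congr (_ + _).
  rewrite -[nseq m (0, a)]cats0 move0 ?cats0 // all_cat hl /= /homogl /= hu.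
  by rewrite all_nseq0.
by case: (m).
Qed.

(** Induction on the number [j] of arguments other than the repeated [a]. The last of them, [c],
    becomes [u = c t] and is absorbed into the repeated argument [a + u], where the induction
    hypothesis holds over the dual numbers. *)
Let Dl_homog j (A : gradedAlgType K) (l : seq (int * A)) (a : A) m :
  size l = j -> all (@homogl K A) l -> a \in homog 0 -> Dl (l ++ nseq m (0, a)) = 0.
Proof.
elim: j A l a m => [|j IHj] A l a m; first by case: l => // _ _; apply: Dl_diag.
case/lastP: l => // l [d c]; rewrite size_rcons all_rcons => -[sl] /andP[hc hl] ha.
pose B := dual A d; pose t : B := dual_t A d.
have Hin := dual_in_morphism A d; have [_ _ _ hin] := Hin.
have ht : t \in homog (- d) := dual_t_deg A d.
have tC i (x : B) : x \in homog i -> gmul x t = dsign K i (- d) *: gmul t x.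
  exact: dual_t_central.
pose in_l := map (fun x : int * A => (x.1, dual_in d x.2)).
have in_homog r : all (@homogl K A) r -> all (@homogl K B) (in_l r).
  by elim: r => //= x r IHr /andP[hx /IHr ->]; rewrite andbT; apply: hin.
have in_Dl r : Dl (in_l r) = dual_in d (Dl r).
  by rewrite /Dl (DL_nat _ Hin) -!map_comp.
pose u : B := gmul (dual_in d c) t.
have hu : u \in homog 0 by rewrite -(subrr d) gmul_deg // hin.
(* Base change extracts a factor t from each occurrence of [u], and t^2 = 0. *)
have uu l1 l2 : all (@homogl K B) l1 -> all (@homogl K B) l2 ->
    Dl (l1 ++ (0, u) :: l2 ++ [:: (0, u)]) = 0.
  move=> h1 h2.
  have base r (k : int) : Dl (r ++ [:: (k, u)]) = gmul (Dl (r ++ [:: (d, dual_in d c)])) t.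
    by rewrite /Dl !cats1 !map_rcons; apply: DL_base ht tC.
  rewrite -cat_cons catA base -catA cat_cons -[l2 ++ _]cats0 move0.
    rewrite catA base !gmul_dual_t.
    by [].
  by rewrite cats0 all_cat h1 /= all_cat h2 /homogl /= hin // andbT hu.
(* One copy more than wanted: the part linear in [u] consists of [m.+1] equal terms with [m] copies
   of [a], and the part without [u] vanishes by induction. *)
have := IHj B (in_l l) (dual_in d a + u) m.+1.
rewrite size_map in_homog // homogD ?hin // => /(_ sl isT isT).
rewrite Dl_expand ?in_homog ?hin // IHj ?size_map ?in_homog ?hin // add0r => /eqP.
rewrite -scaler_nat scaler_eq0 (negPf (char0_natf_neq0 charK _)) //= => /eqP.
rewrite -[nseq m _ ++ _]cats0 => E0.
(* Extracting t from [u] and reading off its coefficient leads back to [A]. *)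
have E1 : Dl (l ++ nseq m (0, a) ++ [:: (d, c)]) = 0.
  have : gmul (Dl (in_l (l ++ nseq m (0, a) ++ [:: (d, c)]))) t = 0.
    rewrite -[RHS]E0 /in_l !map_cat map_nseq /= cats0 /Dl !catA !cats1 !map_rcons.
    by apply/esym; apply: DL_base ht tC.
  by rewrite in_Dl gmul_dual_t => /(congr1 snd).
rewrite cat_rcons -[nseq m _]cats0 /Dl /DL on_list_move ?cats0.
  by rewrite -/(DL _) -/(Dl _) E1 sg0.
by rewrite all_cat hl /= hc all_nseq0.
Qed.

Lemma natural_base_change_eq0 (A : gradedAlgType K) n : D A n = 0.
Proof.
apply: symop_eq; apply: multilinear_eq; first exact: symop_multilinear.
  by move=> v i a x y; rewrite scaler0 addr0.
move=> d v hv; pose l := [seq (d i, v i) | i <- enum 'I_n].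
rewrite (@on_listE _ _ (D A) _ _ (map snd l)).
  have := @Dl_homog _ A l 0 0 erefl; rewrite cats0; apply; rewrite ?homog0 //.
  by apply/allP => _ /mapP[i _ ->]; apply: hv.
by rewrite /l -(map_comp snd).
Qed.

End Vanishing.

(** * Uniqueness *)

Section Uniqueness.
Variables (K : fieldType) (charK : [pchar K] =i pred0).

Section Family.
Variables (P : psi_family K) (HP : higher_koszul P).
Variable A : gradedAlgType K.

(* [Id, x] = x; when Psi_Id reduces to its constant term 1, inserting 1 into
   Psi_x changes the sign. *)
Lemma koszul_insert_one p (x : A) n d (v : {ffun 'I_n -> A}) :
  (forall m w, P A m.+1 (aff_end (gend_id A)) w = 0) ->
  x \in homog p -> has_degs d v ->
  on_list (fun k => P A k (aff_vec x)) (gone :: [seq v i | i <- enum 'I_n]) =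
  - P A n (aff_vec x) v.
Proof.
move=> Id0 hx hv; have hux : aff_deg p (aff_vec x) by split => //; apply: end_deg0.
have := hk_Jacobi HP (Psi_id_deg A) hux hv.
have -> : aff_bracket 0 p (aff_end (gend_id A)) (aff_vec x) = aff_vec x.
  rewrite /aff_bracket /aff_end /aff_vec /= scaler0 subr0; congr (_, _).
  apply: val_inj; apply/funext => a /=.
  by rewrite -[LHS]/(0 - dsign K 0 p *: 0) scaler0 subr0.
move=> E; rewrite {}E /nr_bracket !nr_mulE dsign_sg /=.
have idL l : on_list (fun k => P A k (aff_end (gend_id A))) l = if l is [::] then gone else 0.
  case: l => [|y l]; last by rewrite /on_list Id0.
  rewrite (on_list0 _ [ffun => 0]).
  by have [_ ->] := hk_initial HP x (gend_id A) [ffun => 0].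
rewrite [X in - (X - _)]ush_eq0; last by move=> a b _; rewrite idL.
rewrite sub0r opprK ush_split_first /= idL ush_eq0 ?addr0 // => -[|i a] b _ //=.
by rewrite idL (on_list_zero _ [::]).
Qed.
End Family.

Lemma on_list_const (A : gradedAlgType K) (F : forall n, symop n A) n (a : A) :
  on_list F (nseq n a) = F n [ffun => a].
Proof.
rewrite (@on_list_nth _ _ F a n) ?size_nseq //; congr (F n _).
by apply/ffunP => i; rewrite !ffunE nth_nseq ltn_ord.
Qed.

(** On [K] gauge fixing makes [Psi_Id] constant, so each further argument 1 changes the sign. These
    are the coefficients of [e^(-a)], obtained from the conditions alone. *)
Lemma koszul_K_one (P : psi_family K) (HP : higher_koszul P) n :
  P K^o n (aff_vec (gone : K^o)) [ffun => 1] = (-1) ^+ n.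
Proof.
elim: n => [|n IHn]; first by have [-> _] := hk_initial HP (gone : K^o) (gend_id _) [ffun => 1].
rewrite -(on_list_const (fun k => P K^o k (aff_vec (gone : K^o)))) /=.
have := @koszul_insert_one P HP K^o 0 gone n (fun _ => 0) [ffun => 1].
rewrite IHn exprS mulN1r => <-; rewrite ?gone_deg //.
- congr (on_list _ (_ :: _)); apply: (@eq_from_nth _ 0) => [|i].
    by rewrite size_map size_enum_ord size_nseq.
  rewrite size_nseq => ni; rewrite nth_nseq ni (nth_map (Ordinal ni)) ?size_enum_ord //.
  by rewrite ffunE.
- by move=> m w; rewrite (hk_gauge HP).
by move=> i; rewrite ffunE; apply: (@gone_deg K K^o).
Qed.

Variables (P : psi_family K) (HP : higher_koszul P).
Let HQ := Psi_higher_koszul charK.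

(** The difference of two solutions is natural and multilinear over the centre, and on [K] it
    vanishes by the initial terms and gauge fixing. *)
Lemma koszul_id_eq (A : gradedAlgType K) n : P A n (aff_end (gend_id A)) = Psi A n (aff_end
  (gend_id A)).
Proof.
apply/eqP; rewrite -subr_eq0; apply/eqP.
apply: (@natural_base_change_eq0 _ charK (fun A n => P A n (aff_end (gend_id A)) - Psi A n
  (aff_end (gend_id A)))) => {A n}.
- move=> A B alpha Ha n v; have [la _ _ _] := Ha; rewrite !symopB (linB la).
  have [_ ->] := hk_natural HP Ha 0 (fun a => erefl : gend_id B (alpha a) = alpha (gend_id A
    a)) v.
  by have [_ ->] := hk_natural HQ Ha 0 (fun a => erefl : gend_id B (alpha a) = alpha
    (gend_id A a)) v.
- move=> A k c hc cC n v; rewrite !symopB gmulBl.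
  by have [_ ->] := hk_base_change HP hc cC v; have [_ ->] := hk_base_change HQ hc cC v.
case=> [|n]; rewrite symopB.
  have [_ ->] := hk_initial HP (gone : K^o) (gend_id _) [ffun => 1].
  by have [_ ->] := hk_initial HQ (gone : K^o) (gend_id _) [ffun => 1]; rewrite subrr.
by rewrite (hk_gauge HP) // (hk_gauge HQ) // subrr.
Qed.

Lemma koszul_id0 (A : gradedAlgType K) n w : P A n.+1 (aff_end (gend_id A)) w = 0.
Proof. by rewrite koszul_id_eq (Psi_idE charK). Qed.

Lemma koszul_one_eq (A : gradedAlgType K) n : P A n (aff_vec gone) = Psi A n (aff_vec gone).
Proof.
apply/eqP; rewrite -subr_eq0; apply/eqP.
apply: (@natural_base_change_eq0 _ charK (fun A n => P A n (aff_vec gone) - Psi A n (aff_vec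
  gone))) => {A n}.
- move=> A B alpha Ha n v; have [la a1 _ _] := Ha; rewrite !symopB (linB la).
  have fg : forall a : A, (0 : gend B) (alpha a) = alpha ((0 : gend A) a) by move=> a;
    rewrite (lin0 la).
  have [-> _] := hk_natural HP Ha gone fg v.
  by have [-> _] := hk_natural HQ Ha gone fg v; rewrite a1.
- move=> A k c hc cC n v; rewrite !symopB gmulBl.
  by have [-> _] := hk_base_change HP hc cC v; have [-> _] := hk_base_change HQ hc cC v.
by move=> n; rewrite symopB (koszul_K_one HP) (koszul_K_one HQ) subrr.
Qed.

Variable A : gradedAlgType K.
Notation oneL := (on_list (fun k => Psi A k (aff_vec gone))).

Lemma Psi_one_on_list (l : seq (int * A)) : all (@homogl K A) l ->
  oneL (map snd l) = sexpN (map (@plab K A) l).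
Proof. by move=> hl; rewrite (Psi_on_list (Psi_one_deg A) hl) /= (psi_one charK). Qed.

Lemma nr_mul_subl (F F' G : forall n, symop n A) N d (v : {ffun 'I_N -> A}) :
  nr_mul (fun n => F n - F' n) G d v = nr_mul F G d v - nr_mul F' G d v.
Proof. by rewrite !nr_mulE -ushN -ushD; apply: eq_ush. Qed.

Lemma nr_mul_subr (F G G' : forall n, symop n A) N d (v : {ffun 'I_N -> A}) :
  nr_mul F (fun n => G n - G' n) d v = nr_mul F G d v - nr_mul F G' d v.
Proof.
rewrite !nr_mulE -ushN -ushD; apply: eq_ush => a b.
by rewrite on_list_sub (on_listD _ [::]) (on_listN _ [::]).
Qed.

(* [x, 1] = 0 determines the n-ary part of Psi_x from the lower ones. *)
Lemma koszul_vec_eq p (x : A) : x \in homog p -> forall n, P A n (aff_vec x) = Psi A n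
  (aff_vec x).
Proof.
move=> hx; pose D n := P A n (aff_vec x) - Psi A n (aff_vec x).
have hux : aff_deg p (aff_vec x) by split => //; apply: end_deg0.
suff D0 n : D n = 0 by move=> n; apply/eqP; rewrite -subr_eq0; apply/eqP/D0.
have [m] := ubnP n; elim: m n => // m IHm n; rewrite ltnS => nm.
have {IHm}IH k : (k < n)%N -> D k = 0 by move=> kn; apply: IHm; apply: leq_trans nm.
case: n => [|n] in nm IH *.
  apply: symop_eq => v; rewrite /D symopB.
  have [-> _] := hk_initial HP x (gend_id A) v.
  by have [-> _] := hk_initial HQ x (gend_id A) v; rewrite subrr.
have DL0 l : (size l < n.+1)%N -> on_list D l = 0 by move=> sl; rewrite /on_list IH.
apply: symop_eq; apply: multilinear_eq; first exact: symop_multilinear.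
  by move=> v i a y z; rewrite scaler0 addr0.
move=> d v hv; rewrite symop0.
have Dv : D n.+1 v = on_list D [seq v i | i <- enum 'I_n.+1] by apply: on_listE.
have D1 r : map v r = [seq v i | i <- enum 'I_n.+1] ->
    on_list D (gone :: map v r) = - D n.+1 v.
  move=> ->; rewrite on_list_sub (koszul_insert_one HP (@koszul_id0 A) hx hv).
  by rewrite (koszul_insert_one HQ (@Psi_idE _ charK A) hx hv) -opprD.
have br0 : aff_bracket p 0 (aff_vec x) (aff_vec (gone : A)) = 0.
  rewrite /aff_bracket /aff_vec /= scaler0 subr0; congr (_, _).
  apply: val_inj; apply/funext => a.
  by rewrite -[LHS]/(0 - dsign K p 0 *: 0) scaler0 subr0.
(* The Jacobi identities of both families for [[x, 1] = 0] are subtracted; [Psi_1] is common to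
   them. *)
have E : nr_mul D (fun k => Psi A k (aff_vec gone)) d v =
    nr_mul (fun k => Psi A k (aff_vec gone)) D d v.
  have JP := hk_Jacobi HP hux (Psi_one_deg A) hv.
  have JQ := hk_Jacobi HQ hux (Psi_one_deg A) hv.
  move: JP JQ; rewrite br0 !linear0 !symop0 /nr_bracket !dsign_sg !andbF /sg.
  have -> : (fun k => P A k (aff_vec gone)) = (fun k => Psi A k (aff_vec gone)).
    by apply: functional_extensionality_dep => k; apply: koszul_one_eq.
  move=> /eqP; rewrite eq_sym subr_eq0 => /eqP JP /eqP; rewrite eq_sym subr_eq0 => /eqP JQ.
  by rewrite nr_mul_subl nr_mul_subr JP JQ.
pose h (i : 'I_n.+1) := (d i, v i).
have hE r : map v r = map snd (map h r) by rewrite -(map_comp snd).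
have hh r : all (@homogl K A) (map h r) by apply/allP => _ /mapP[i _ ->]; apply: hv.
have one0 : oneL [::] = gone by rewrite (Psi_one_on_list (l := [::])) // /sexpN sexp0 scale1r.
have one1 i : oneL [:: v i] = - v i.
  by rewrite -[[:: v i]]/(map v [:: i]) hE Psi_one_on_list ?hh //= /sexpN sexp1 expr1 scaleN1r.
(* On the right [D] must take all [n.+1] arguments, which gives [- D v]. On the left the empty part
   gives [D(1, v) = - D v], each of the [n.+1] single entries gives another [- D v], and longer
   parts leave [D] too few arguments. Hence [D v *+ n.+1 = 0]. *)
move: E; rewrite !nr_mulE [RHS]ush_split_last [X in _ + X]ush_eq0; last first.
  move=> a [|i b] Hs //=; rewrite DL0 ?(on_list_zero _ [::]) // size_map.
  by move: Hs; rewrite size_enum_ord /=; lia.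
rewrite addr0 ush_split_first /= one0 D1 // -Dv.
have -> : oneL [:: D n.+1 v] = - D n.+1 v.
  have hD : D n.+1 v \in homog (\sum_i d i + p).
    by apply: homogB; [have [_ _] := hk_degree HP hux n.+1 | have [_ _] := hk_degree HQ hux
      n.+1]; apply.
  have := @Psi_one_on_list [:: (\sum_i d i + p, D n.+1 v)].
  by rewrite /= /homogl hD => -> //; rewrite /sexpN sexp1 expr1 scaleN1r.
move=> /(canRL (addKr _)); rewrite addNr.
have -> : ush (podd \o d) (enum 'I_n.+1) (fun a b =>
    if nilp a then 0 else on_list D (oneL (map v a) :: map v b)) =
  - ush (podd \o d) (enum 'I_n.+1) (fun a b =>
    if a is [:: i] then on_list D (map v (i :: b)) else 0).
  rewrite -ushN; apply: ush_congr => -[|i [|j a]] b Hs _ _ /=; rewrite ?oppr0 //.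
    by rewrite one1 (on_listN _ [::]).
  rewrite DL0 //= size_map; move: Hs; rewrite /= size_enum_ord; lia.
rewrite (ush_single _ (on_list_swap _ hv)) size_enum_ord -Dv => /eqP.
rewrite oppr_eq0 -scaler_nat scaler_eq0 (negPf (char0_natf_neq0 charK _)) //=.
by move/eqP.
Qed.

(* [f, x] = f x determines the values Psi_f(x, ...) from the lower ones. *)
Lemma koszul_end_eq p (f : gend A) : end_deg p f ->
  forall n, P A n (aff_end f) = Psi A n (aff_end f).
Proof.
move=> hf; pose D n := P A n (aff_end f) - Psi A n (aff_end f).
have huf : aff_deg p (aff_end f) by split => //; apply: homog0.
suff D0 n : D n = 0 by move=> n; apply/eqP; rewrite -subr_eq0; apply/eqP/D0.
have [m] := ubnP n; elim: m n => // m IHm n; rewrite ltnS => nm.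
have {IHm}IH k : (k < n)%N -> D k = 0 by move=> kn; apply: IHm; apply: leq_trans nm.
case: n => [|n] in nm IH *.
  apply: symop_eq => v; rewrite /D symopB.
  have [_ ->] := hk_initial HP 0 f v.
  by have [_ ->] := hk_initial HQ 0 f v; rewrite subrr.
have DL0 l : (size l < n.+1)%N -> on_list D l = 0 by move=> sl; rewrite /on_list IH.
apply: symop_eq; apply: multilinear_eq; first exact: symop_multilinear.
  by move=> v i a y z; rewrite scaler0 addr0.
move=> d w hw; rewrite symop0.
(* The first argument becomes the vector of the bracket [[f, x]]; the other [n] remain arguments. *)
pose x := w ord0; pose v : {ffun 'I_n -> A} := [ffun i => w (lift ord0 i)].
pose e (i : 'I_n) := d (lift ord0 i).
have hx : x \in homog (d ord0) := hw ord0.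
have hv : has_degs e v by move=> i; rewrite ffunE; apply: hw.
have hux : aff_deg (d ord0) (aff_vec x) by split => //; apply: end_deg0.
have -> : D n.+1 w = on_list D (x :: [seq v i | i <- enum 'I_n]).
  apply: on_listE; rewrite enum_ordSl /= -(map_comp w); congr (_ :: _).
  by apply: eq_map => i; rewrite ffunE.
have br : aff_bracket p (d ord0) (aff_end f) (aff_vec x) = aff_vec (f x).
  rewrite /aff_bracket /aff_vec /= scaler0 subr0; congr (_, _).
  apply: val_inj; apply/funext => a.
  by rewrite -[LHS]/(f 0 - dsign K p (d ord0) *: 0) linear0 scaler0 subr0.
have hfx : f x \in homog (d ord0 + p) by case: hf => _; apply.
have : nr_mul D (fun k => Psi A k (aff_vec x)) e v =
    dsign K p (d ord0) *: nr_mul (fun k => Psi A k (aff_vec x)) D e v.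
  have JP := hk_Jacobi HP huf hux hv; have JQ := hk_Jacobi HQ huf hux hv.
  move: JP JQ; rewrite br (koszul_vec_eq hfx) => -> /eqP.
  have -> : (fun k => P A k (aff_vec x)) = (fun k => Psi A k (aff_vec x)).
    by apply: functional_extensionality_dep => k; apply: koszul_vec_eq hx _.
  rewrite /nr_bracket nr_mul_subl nr_mul_subr scalerBr => /eqP/(canRL (subrK _)) ->.
  by rewrite addrAC [X in X + _]addrAC subrr sub0r addrC.
(* With [n] arguments in all, [D] inside [Psi_x] has arity at most [n] and vanishes. On the left
   only the empty part leaves [D] with [n.+1] arguments, the first being the initial term [x]. *)
rewrite !nr_mulE [X in _ *: X]ush_eq0 ?scaler0; last first.
  move=> a b Hs; rewrite DL0 ?(on_list_zero _ [::]) // size_map.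
  move: Hs; rewrite size_enum_ord ltnS => /eq_leq; apply: leq_trans; exact: leq_addr.
rewrite ush_split_first /= [X in _ + X]ush_eq0 ?addr0 => [|[|i a] b Hs //=]; last first.
  rewrite DL0 //= size_map; move: Hs; rewrite size_enum_ord /=; lia.
rewrite (on_list0 _ [ffun => 0]).
by have [-> _] := hk_initial HQ x (gend_id A) [ffun => 0].
Qed.

Lemma koszul_eq n (u : aff A) : P A n u = Psi A n u.
Proof.
case: u => x f.
have -> : (x, f) = aff_vec x + aff_end f :> aff A.
  by rewrite -[RHS]/(_, _) /= addr0 add0r.
rewrite !linearD; congr (_ + _).
  elim/homog_ind: x => [|x y IHx IHy|p x hx]; last exact: koszul_vec_eq hx n.
    by rewrite -[aff_vec 0]/(0 : aff A) !linear0.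
  have -> : aff_vec (x + y) = aff_vec x + aff_vec y by rewrite -[RHS]/(_, _) /= addr0.
  by rewrite !linearD IHx IHy.
case: f => f pf; have /asboolP Hf := pf; elim/deg_sum_ind: Hf pf => [|k g h hg IHh] pf.
  have -> : aff_end (GEnd pf) = 0 by congr (_, _); apply: val_inj.
  by rewrite !linear0.
have pg : g \in @gend_pred K A by apply/asboolP/(deg_sum_base (k := k)).
(* The induction does not record that the remainder [h] lies in End; it does, as a difference of two
   such maps. *)
have ph : h \in @gend_pred K A.
  rewrite (_ : h = gend_fun (GEnd pf - GEnd pg)); last first.
    by apply/funext => a; rewrite -[RHS]/((g a + h a) - g a) addrAC subrr add0r.
  exact: valP.
have -> : aff_end (GEnd pf) = aff_end (GEnd pg) + aff_end (GEnd ph).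
  by rewrite -[RHS]/(_, _) /= addr0; congr (_, _); apply: val_inj.
by rewrite !linearD IHh (@koszul_end_eq k).
Qed.

End Uniqueness.

Theorem theorem2p1 (K : fieldType) (charK : [pchar K] =i pred0) :
  exists Psi : psi_family K,
    higher_koszul Psi /\
    forall Psi' : psi_family K, higher_koszul Psi' ->
      forall (A : gradedAlgType K) (n : nat) (u : aff A), Psi' A n u = Psi A n u.
Proof.
exists (@Psi K); split; first exact: Psi_higher_koszul.
by move=> P HP A n u; apply: koszul_eq.
Qed.
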